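(* Let $\varepsilon\in(0,\tfrac12)$ be constant and let $k=k(n)$ satisfy $(2+\varepsilon)\log_2 n\le k\le n^{1/2-\varepsilon}$. If the quantum strong search planted-clique conjecture holds, then for every constant $c>0$ and every constant $\tau\in(0,1)$ no efficient quantum algorithm, given $G$ and $k$, prepares, to trace distance $\tau$ and with probability $\ge n^{-c}$ over $G\sim G(n,\tfrac12,k)$, the maximally mixed state $\Pi_0/\beta_{k-2}$ on $\ker\Delta_{k-2}$.
   Context: Graphs are simple graphs on $[n]=\{1,\dots,n\}$. $G(n,\tfrac12)$ is the Erdős–Rényi distribution (each edge present independently with probability $\tfrac12$). $G(n,\tfrac12,k)$ is obtained by drawing $G_0\sim G(n,\tfrac12)$, choosing a uniformly random $k$-subset $S\subseteq[n]$ and adding every edge inside $S$. The clique complex $X(G)$ is the simplicial complex whose $d$-simplices are the $(d+1)$-cliques of $G$; $\mathrm{skel}_dX(G)$ keeps exactly the faces of dimension $\le d$. Chains are over the reals, with the $d$-simplices as orthonormal basis, a simplex $\sigma$ being encoded as the computational basis state $|\sigma\rangle$. With $\partial_d$ the simplicial boundary map of $\mathrm{skel}_{k-2}X(G)$, $\Delta_{k-2}=\partial_{k-2}^{\top}\partial_{k-2}+\partial_{k-1}\partial_{k-1}^{\top}$ is the combinatorial Laplacian of $\mathrm{skel}_{k-2}X(G)$ (here $\partial_{k-1}=0$). $\Pi_0$ is the orthogonal projector onto $\ker\Delta_{k-2}$, and $\beta_{k-2}=\dim\ker\Delta_{k-2}=\dim H_{k-2}(\mathrm{skel}_{k-2}X(G);\mathbb{R})$.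 Trace distance is $\tfrac12\|\rho-\rho'\|_1$. Efficient means running in time $\mathrm{poly}(n)$. ''No algorithm achieves probability at least $q(n)$'' means that no algorithm achieves this for all sufficiently large $n$. Strong search planted-clique conjecture (quantum version): for all constants $\varepsilon>0$, $\alpha\in(0,\tfrac12)$ and $c>0$, every quantum polynomial-time algorithm fails to find a $k$-clique in $G\sim G(n,\tfrac12,k)$ with probability at least $1-n^{-c}$ (i.e. succeeds with probability at most $n^{-c}$), for all sufficiently large $n$ and all $k$ with $(2+\varepsilon)\log_2 n\le k\le n^{1/2-\alpha}$. *)

(* Defs.v *)
From HB Require Import structures.
From mathcomp Require Import all_boot all_order all_algebra.
From mathcomp Require Import sesquilinear spectral.
From mathcomp Require Import complex.
From mathcomp Require Import reals exp.

Set Implicit Arguments.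
Unset Strict Implicit.
Unset Printing Implicit Defensive.

Import Order.TTheory GRing.Theory Num.Theory.
Local Open Scope ring_scope.
Local Open Scope sesquilinear_scope.
Local Open Scope complex_scope.

(* The vertices 1, ..., n are represented by 0, ..., n-1, i.e. by ['I_n].  A
  simple graph is its set of edges, a subset of [vpairs n]. *)

Definition vpairs (n : nat) : {set {set 'I_n}} :=
  [set e : {set 'I_n} | #|e| == 2].

Definition is_graph (n : nat) (G : {set {set 'I_n}}) : bool := G \subset vpairs n.

Definition clique (n : nat) (G : {set {set 'I_n}}) (S : {set 'I_n}) : bool :=
  [forall u in S, forall v in S, (u != v) ==> ([set u; v] \in G)].

Definition kclique (n k : nat) (G : {set {set 'I_n}}) (S : {set 'I_n}) : bool :=
  (#|S| == k) && clique G S.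

(* Probability of the graph [G] under G(n, 1/2). *)
Definition er_weight (R : realType) (n : nat) (G : {set {set 'I_n}}) : R :=
  \prod_(e in vpairs n) (if e \in G then 2^-1 else 1 - 2^-1).

Definition plant (n : nat) (G : {set {set 'I_n}}) (S : {set 'I_n}) :
    {set {set 'I_n}} :=
  G :|: [set e in vpairs n | e \subset S].

(* Expectation of [f G] for G drawn from G(n, 1/2, k), where k <= n. *)
Definition planted_expect (R : realType) (n k : nat)
    (f : {set {set 'I_n}} -> R) : R :=
  \sum_(G | is_graph G) \sum_(S : {set 'I_n} | #|S| == k)
     er_weight R G / 'C(n, k)%:R * f (plant G S).

Definition planted_prob (R : realType) (n k : nat)
    (P : {set {set 'I_n}} -> bool) : R :=
  planted_expect k (fun G => (P G)%:R).

(* The machine model is a classical random-access controller driving a quantum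
  memory.  The controller holds finitely many natural-number variables, has
  read-only access to the input (n, k and the adjacency matrix of G), and may
  apply gates of the universal set {X, H, T, CNOT} to, or measure in the
  computational basis, the qubits whose addresses it computes; later
  instructions may depend on measurement outcomes.  A program is a fixed finite
  object, independent of the input, and every instruction takes one unit of
  time.  There is no multiplication, so that within polynomial time the
  variables only reach values of polynomial bit length.

  The memory consists of an n-qubit output register (addresses 0, ..., n-1)
  followed by [w] work qubits (addresses n, ..., n+w-1), all initially |0>.
  A computational basis state is identified with the set of qubits in state
  |1>; thus a vertex set S is encoded in the output register by its indicator
  bit string. *)

Inductive expr : Type :=
| Cst of nat
| Var of nat
| InputN
| InputK
| InputEdge of expr & expr
| Add of expr & expr
| Sub of expr & expr.

Inductive gate : Type := GateX | GateH | GateT.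

Inductive cmd : Type :=
| Assign of nat & expr
| Gate of gate & expr
| CNot of expr & expr
| Measure of nat & expr
| If of expr & seq cmd & seq cmd
| While of expr & seq cmd.

(* 1 if the vertices numbered [x] and [y] are adjacent; 0 otherwise, and in
   particular if [x] or [y] is not smaller than [n]. *)
Definition edge_query (n : nat) (G : {set {set 'I_n}}) (x y : nat) : nat :=
  [exists u : 'I_n, exists v : 'I_n,
     [&& u == x :> nat, v == y :> nat & [set u; v] \in G]].

Fixpoint eval (n : nat) (G : {set {set 'I_n}}) (k : nat) (m : nat -> nat)
    (e : expr) : nat :=
  match e with
  | Cst a => a
  | Var x => m x
  | InputN => n
  | InputK => k
  | InputEdge e1 e2 => edge_query G (eval G k m e1) (eval G k m e2)
  | Add e1 e2 => (eval G k m e1 + eval G k m e2)%N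
  | Sub e1 e2 => (eval G k m e1 - eval G k m e2)%N
  end.

Definition set_var (m : nat -> nat) (x a : nat) : nat -> nat :=
  fun y => if y == x then a else m y.

Definition qubit (n w : nat) : finType := ('I_n + 'I_w)%type.

(* State vectors, not necessarily normalised. *)
Definition qstate (R : realType) (n w : nat) : zmodType :=
  {ffun {set qubit n w} -> R[i]}.

Definition qubit_at (n w : nat) (a : nat) : option (qubit n w) :=
  omap (@split n w) (insub a).

Definition flip (T : finType) (q : T) (B : {set T}) : {set T} :=
  if q \in B then B :\ q else q |: B.

Definition ket0 (R : realType) (n w : nat) : qstate R n w :=
  [ffun B : {set qubit n w} => (B == set0)%:R].

(* Gates and measurements at an address outside the memory do nothing (and
   return the outcome 0); so does a CNOT whose two addresses coincide. *)
Definition apply_gate (R : realType) (n w : nat) (g : gate)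
    (a : option (qubit n w)) (psi : qstate R n w) : qstate R n w :=
  if a is Some q then
    [ffun B : {set qubit n w} =>
      match g with
      | GateX => psi (flip q B)
      | GateH => (psi (B :\ q) + (-1) ^+ (q \in B) * psi (q |: B)) / sqrtC 2
      | GateT => (if q \in B then (1 +i* 1) / sqrtC 2 else 1) * psi B
      end]
  else psi.

Definition apply_cnot (R : realType) (n w : nat) (a b : option (qubit n w))
    (psi : qstate R n w) : qstate R n w :=
  if (a, b) is (Some p, Some q) then
    if p == q then psi
    else [ffun B : {set qubit n w} => psi (if p \in B then flip q B else B)]
  else psi.

Definition project (R : realType) (n w : nat) (a : option (qubit n w))
    (b : bool) (psi : qstate R n w) : qstate R n w :=
  [ffun B : {set qubit n w} =>
    if (if a is Some q then q \in B else false) == b then psi B else 0].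

(* A branch of the computation: the instructions still to be executed, the
   classical variables and the state vector, whose squared norm is the
   probability of the branch. *)
Definition branch (R : realType) (n w : nat) : Type :=
  (seq cmd * (nat -> nat) * qstate R n w)%type.

(* A measurement splits a branch according to its outcome; an outcome of
   probability zero produces no branch. *)
Definition step (R : realType) (n w : nat) (G : {set {set 'I_n}}) (k : nat)
    (c : branch R n w) : seq (branch R n w) :=
  let: (p, m, psi) := c in
  let ev := eval G k m in
  let at_ e := qubit_at n w (ev e) in
  if p is i :: p' then
    match i with
    | Assign x e => [:: (p', set_var m x (ev e), psi)]
    | Gate g e => [:: (p', m, apply_gate g (at_ e) psi)]
    | CNot e1 e2 => [:: (p', m, apply_cnot (at_ e1) (at_ e2) psi)]
    | Measure x e =>
        [seq c' <- [seq (p', set_var m x (nat_of_bool b), project (at_ e) b psi)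
                   | b <- [:: false; true]] | c'.2 != 0]
    | If e p1 p2 => [:: ((if ev e != 0%N then p1 else p2) ++ p', m, psi)]
    | While e p1 => [:: (if ev e != 0%N then p1 ++ p else p', m, psi)]
    end
  else [:: c].

Definition run (R : realType) (n w : nat) (p : seq cmd)
    (G : {set {set 'I_n}}) (k t : nat) : seq (branch R n w) :=
  iter t (fun cs => flatten (map (step G k) cs))
    [:: (p, fun=> 0%N, ket0 R n w)].

Definition halted (R : realType) (n w : nat) (c : branch R n w) : bool :=
  nilp c.1.1.

Definition polybound (d n : nat) : nat := (n ^ d + d)%N.

(* A program together with polynomial bounds on its number of work qubits and
   on its worst-case running time over all inputs and measurement outcomes. *)
Record poly_quantum_alg (R : realType) : Type := PolyQuantumAlg {
  alg_prog : seq cmd;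
  alg_space : nat;
  alg_time : nat;
  alg_halts : forall (n k : nat) (G : {set {set 'I_n}}),
    is_graph G -> (k <= n)%N ->
    all (@halted R n (polybound alg_space n))
      (run R (polybound alg_space n) alg_prog G k (polybound alg_time n))
}.

(* Density matrices on the output register are indexed by the enumeration of
   the computational basis, that is, of the subsets of the vertex set. *)
Definition basis_size (n : nat) : nat := #|{: {set 'I_n}}|.

Definition embed (n w : nat) (S : {set 'I_n}) (W : {set 'I_w}) :
    {set qubit n w} :=
  [set inl u | u in S] :|: [set inr v | v in W].

(* Final state of the output register: the work qubits are traced out and the
   measurement outcomes forgotten. *)
Definition alg_output (R : realType) (A : poly_quantum_alg R) (n : nat)
    (G : {set {set 'I_n}}) (k : nat) : 'M[R[i]]_(basis_size n) :=
  let w := polybound (alg_space A) n in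
  \sum_(c <- run R w (alg_prog A) G k (polybound (alg_time A) n))
    \matrix_(i, j) \sum_(W : {set 'I_w})
      c.2 (embed (enum_val i) W) * (c.2 (embed (enum_val j) W))^*%R.

(* Probability that measuring the output register yields a k-clique of [G]. *)
Definition find_prob (R : realType) (A : poly_quantum_alg R) (n : nat)
    (G : {set {set 'I_n}}) (k : nat) : R :=
  \sum_(i < basis_size n | kclique k G (enum_val i))
    complex.Re (alg_output A G k i i).

Definition log2 (R : realType) (n : nat) : R := ln n%:R / ln 2.

Definition planted_range (R : realType) (eps alpha : R) (n k : nat) : bool :=
  ((2 + eps) * log2 R n <= k%:R) && (k%:R <= n%:R `^ (2^-1 - alpha)).

Definition strong_search_planted_clique_conjecture (R : realType) : Prop :=
  forall eps alpha c : R, 0 < eps -> 0 < alpha < 2^-1 -> 0 < c ->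
  forall A : poly_quantum_alg R,
  exists N : nat, forall n k : nat, (N <= n)%N -> planted_range eps alpha n k ->
    planted_expect k (fun G : {set {set 'I_n}} => find_prob A G k)
      <= n%:R `^ (- c).

Definition clique_complex (n : nat) (G : {set {set 'I_n}}) : {set {set 'I_n}} :=
  [set S | (S != set0) && clique G S].

Definition skel (n d : nat) (K : {set {set 'I_n}}) : {set {set 'I_n}} :=
  [set S in K | (#|S| <= d.+1)%N].

Definition simplices (n : nat) (K : {set {set 'I_n}}) (d : nat) :
    {set {set 'I_n}} :=
  [set S in K | #|S| == d.+1].

(* The boundary map from d-chains to (d-1)-chains, acting on column vectors,
   for the orientation by increasing vertices.  The complex is not augmented:
   for d = 0 the formula gives the zero matrix. *)
Definition boundary (R : realType) (n : nat) (K : {set {set 'I_n}}) (d : nat) :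
    'M[R]_(#|simplices K d.-1|, #|simplices K d|) :=
  \matrix_(i, j)
    let s : {set 'I_n} := enum_val i in
    let t : {set 'I_n} := enum_val j in
    \sum_(v in t | t :\ v == s) (-1) ^+ #|[set u in t | (u < v)%N]|.

Definition laplacian (R : realType) (n : nat) (K : {set {set 'I_n}}) (d : nat) :
    'M[R]_#|simplices K d| :=
  (boundary R K d)^T *m boundary R K d
  + boundary R K d.+1 *m (boundary R K d.+1)^T.

(* [kermx] is a left kernel: its rows span the transposes of the columns
   annihilated by the Laplacian. *)
Definition harmonic (R : realType) (n : nat) (K : {set {set 'I_n}}) (d : nat) :
    'M[R]_#|simplices K d| :=
  kermx (laplacian R K d)^T.

Definition betti (R : realType) (n : nat) (K : {set {set 'I_n}}) (d : nat) : nat :=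
  \rank (harmonic R K d).

Definition harmonic_proj (R : realType) (n : nat) (K : {set {set 'I_n}})
    (d : nat) : 'M[R[i]]_#|simplices K d| :=
  proj_ortho (map_mx (real_complex R) (harmonic R K d)).

(* The isometry sending a d-simplex to its computational basis state. *)
Definition simplex_ket (R : realType) (n : nat) (K : {set {set 'I_n}})
    (d : nat) : 'M[R[i]]_(basis_size n, #|simplices K d|) :=
  \matrix_(i, j) ((enum_val i : {set 'I_n}) == enum_val j)%:R.

Definition harmonic_state (R : realType) (n : nat) (K : {set {set 'I_n}})
    (d : nat) : 'M[R[i]]_(basis_size n) :=
  (betti R K d)%:R^-1 *:
    (simplex_ket R K d *m harmonic_proj R K d *m (simplex_ket R K d)^T).

Definition target_state (R : realType) (n : nat) (G : {set {set 'I_n}})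
    (k : nat) : 'M[R[i]]_(basis_size n) :=
  harmonic_state R (skel (k - 2) (clique_complex G)) (k - 2).

(* Sum of the singular values. *)
Definition trace_norm (R : realType) (m : nat) (M : 'M[R[i]]_m) : R[i] :=
  \sum_i sqrtC (spectral_diag (M^t* *m M) 0 i).

Definition trace_dist (R : realType) (m : nat) (M M' : 'M[R[i]]_m) : R[i] :=
  2^-1 * trace_norm (M - M').

Definition prepares_target (R : realType) (A : poly_quantum_alg R) (tau : R)
    (n : nat) (G : {set {set 'I_n}}) (k : nat) : bool :=
  trace_dist (alg_output A G k) (target_state R G k) <= tau%:C.

(* Main.v *)
Require Import Defs.
From mathcomp Require Import all_boot all_order all_algebra.
From mathcomp Require Import reals exp.
From mathcomp Require Import sesquilinear spectral complex sequences.
From mathcomp Require Import zify ring lra.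
Local Open Scope ring_scope.

(* A k-clique is found by measuring the prepared state, which yields a
   (k-1)-clique s, and then looking for a vertex adjacent to all of s.

   In the (k-2)-skeleton there are no (k-1)-chains, so ker Delta_(k-2) is the
   space of (k-2)-cycles and s lies in the support of a cycle: every facet
   s \ v of s is contained in another (k-1)-clique (s \ v) + w_v.  If s is in no
   k-clique, then w_v is not adjacent to v, so the w_v are distinct, and w_v is
   outside the planted set S whenever v is in S.  Hence, for any constant m,
   either s has at least m vertices outside S, or some m vertices outside S are
   all adjacent to a common set of k - 2m vertices of S.  By a union bound both
   events have probability at most poly(n) q^m, where q = n k / 2^((k-2)/2) is
   at most n^(-eps/4).  As m is arbitrary, this is negligible against every
   n^(-c), although the probability that planting creates a second k-clique is
   only polynomially small.

   The trace distance bounds the total variation distance of the measurement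
   outcomes, so the search succeeds with probability at least 1 - tau on all
   other graphs. *)

Set Implicit Arguments.
Unset Strict Implicit.
Unset Printing Implicit Defensive.
Import Order.TTheory GRing.Theory Num.Theory.

(** * Branches of a computation *)

Section Execution.
Variables (R : realType) (n w : nat) (G : {set {set 'I_n}}) (k : nat).
Local Notation C := R[i].
Local Notation config := (branch R n w).
Implicit Types (c : config) (psi : qstate R n w) (m : nat -> nat) (B : {set qubit n w}).
Implicit Types (p q : seq cmd).

Definition branches (t : nat) (c : config) : seq config :=
  iter t (fun cs => flatten (map (step G k) cs)) [:: c].

Lemma iter_steps t (cs : seq config) :
  iter t (fun cs => flatten (map (step G k) cs)) cs
  = flatten (map (branches t) cs).
Proof.
elim: t => [|t IHt] /=; first by elim: cs => //= c cs {1}->.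
rewrite IHt; elim: cs {IHt} => //= c cs IHc.
by rewrite map_cat flatten_cat IHc.
Qed.

Lemma branchesS t c : branches t.+1 c = flatten (map (branches t) (step G k c)).
Proof. by rewrite /branches iterSr /= cats0 iter_steps. Qed.

Lemma branches_nil t m psi : branches t ([::], m, psi) = [:: ([::], m, psi)].
Proof. by elim: t => //= t ->. Qed.

Lemma branches_halted_add t s c :
  all (@halted R n w) (branches t c) -> branches (t + s) c = branches t c.
Proof.
move=> ht; rewrite /branches addnC iterD iter_steps -/(branches t c).
elim: (branches t c) ht => //= -[[[|//] m] psi] cs IHc /= /IHc ->.
by rewrite branches_nil.
Qed.

Definition append_prog q c : config := (c.1.1 ++ q, c.1.2, c.2).

Lemma step_append q i p m psi :
  step G k ((i :: p) ++ q, m, psi)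
  = map (append_prog q) (step G k (i :: p, m, psi)).
Proof.
case: i => //= [x e|e p1 p2|e p1].
- by rewrite /append_prog; do 2!case: ifP => //=.
- by rewrite /append_prog /=; case: ifP; rewrite catA.
- by rewrite /append_prog /=; case: ifP; rewrite // -catA.
Qed.

(** A branch may finish [p] early and enter [q] before time [t]; as [q] then halts within its own
    [s] steps and halted branches are fixed, the surplus time changes nothing. Halting of [q] is
    asked from nonzero states only, which is what [classical_halted] can deliver. *)
Lemma branches_cat q s :
  (forall m psi, psi != 0 -> all (@halted R n w) (branches s (q, m, psi))) ->
  forall t p m psi, all (@halted R n w) (branches t (p, m, psi)) ->
  all (fun c => c.2 != 0) (branches t (p, m, psi)) ->
  branches (t + s) (p ++ q, m, psi)
  = flatten [seq branches s (append_prog q c) | c <- branches t (p, m, psi)].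
Proof.
move=> hq; elim=> [|t IHt] p m psi.
  by rewrite /= andbT /halted /= => /nilP -> _; rewrite cats0.
case: p => [|i p].
  rewrite branches_nil => _ /andP[nz _]; rewrite [RHS]cats0.
  by rewrite addnC [LHS]branches_halted_add // hq.
rewrite addSn !branchesS step_append.
elim: (step _ _ _) => //= -[[p' m'] psi'] cs IHc.
rewrite !all_cat => /andP[h1 h2] /andP[g1 g2].
by rewrite map_cat flatten_cat -IHc // -IHt.
Qed.

Definition sqnorm (f : {set qubit n w} -> C) psi : C :=
  \sum_B f B * `|psi B| ^+ 2.

(** The expectation of [f] when the whole memory is finally measured in the computational basis. The
    squared norm of a branch is its probability, so no normalisation occurs. *)
Definition weight (f : seq cmd -> (nat -> nat) -> {set qubit n w} -> C)
    (cs : seq config) : C :=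
  \sum_(c <- cs) sqnorm (f c.1.1 c.1.2) c.2.

Lemma sqnorm_eq0 psi : (sqnorm (fun=> 1) psi == 0) = (psi == 0).
Proof.
rewrite /sqnorm psumr_eq0; last by move=> B _; rewrite mul1r exprn_ge0.
apply/idP/eqP => [/allP h|->]; last first.
  by apply/allP => B _; rewrite ffunE normr0 mul1r expr0n /= eqxx.
  apply/ffunP=> B; rewrite ffunE; apply/eqP.
  have := h B (mem_index_enum _).
  by rewrite mul1r expf_eq0 /= normr_eq0.
Qed.

Lemma flipK (T : finType) (q : T) : involutive (flip q).
Proof.
move=> B; rewrite /flip; have [qB|qB] := boolP (q \in B).
  by rewrite setD11 setD1K.
by rewrite setU11 setU1K.
Qed.

Lemma sum_pair (T : finType) (q : T) (f : {set T} -> C) :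
  \sum_D f D = \sum_(D : {set T} | q \notin D) (f D + f (q |: D)).
Proof.
rewrite (bigID (fun D : {set T} => q \in D)) /= addrC big_split /=; congr (_ + _).
rewrite (reindex_onto (fun D : {set T} => q |: D) (fun D : {set T} => D :\ q)) /=;
  last first.
  by move=> D qD; rewrite setD1K.
apply: eq_bigl => D; rewrite !inE eqxx /=.
apply/eqP/idP => [<-|qD]; first by rewrite !inE eqxx.
by rewrite setU1K.
Qed.

Lemma parallelogram (a b : C) :
  `|a + b| ^+ 2 + `|a - b| ^+ 2 = 2 * (`|a| ^+ 2 + `|b| ^+ 2).
Proof. by rewrite !normCK !rmorphD !rmorphN /=; ring. Qed.

Lemma sqrtC2_norm : `|sqrtC 2 : C| ^+ 2 = 2.
Proof. by rewrite -normrX sqrtCK ger0_norm. Qed.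

Lemma norm_1i : `|(Complex 1 1 : C)| ^+ 2 = 2.
Proof.
rewrite -add_Re2_Im2 /= expr1n; apply/eqP.
by rewrite eq_complex /= addr0 !eqxx.
Qed.

Lemma sqnorm_gate g a psi :
  sqnorm (fun=> 1) (apply_gate g a psi) = sqnorm (fun=> 1) psi.
Proof.
case: a => // q; rewrite /sqnorm; case: g => /=.
- rewrite [RHS](reindex_inj (inv_inj (flipK q))) /=.
  by apply: eq_bigr => B _; rewrite ffunE.
- rewrite (sum_pair q) [RHS](sum_pair q); apply: eq_bigr => B qB.
  rewrite !ffunE !inE eqxx (negbTE qB) /= expr0 expr1 !mul1r setU1K //.
  have -> : B :\ q = B.
    by apply/setP=> u; rewrite !inE; case: eqP => // ->; rewrite (negbTE qB).
  rewrite setUA setUid mulN1r !normrM !normfV !exprMn !exprVn sqrtC2_norm.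
  by rewrite -mulrDl parallelogram mulrAC divff ?mul1r // pnatr_eq0.
- apply: eq_bigr => B _; rewrite ffunE normrM exprMn; case: ifP => _.
    by rewrite normrM normfV exprMn exprVn norm_1i sqrtC2_norm divff ?mul1r // pnatr_eq0.
  by rewrite normr1 expr1n mul1r.
Qed.

Lemma sqnorm_cnot a b psi :
  sqnorm (fun=> 1) (apply_cnot a b psi) = sqnorm (fun=> 1) psi.
Proof.
case: a b => [p|] [q|] //=; rewrite /apply_cnot; case: eqP => [//|/eqP pq].
rewrite /sqnorm [RHS](reindex_inj
  (h := fun B : {set qubit n w} => if p \in B then flip q B else B)).
  by apply: eq_bigr => B _; rewrite ffunE.
apply: inv_inj => B /=; have [pB|/negbTE pB] := boolP (p \in B); last by rewrite pB.
suff -> : p \in flip q B by rewrite flipK.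
by rewrite /flip; case: ifP => _; rewrite !inE pB ?pq ?orbT.
Qed.

Lemma weight_cons f c cs :
  weight f (c :: cs) = sqnorm (f c.1.1 c.1.2) c.2 + weight f cs.
Proof. exact: big_cons. Qed.

Lemma weight_cat f cs1 cs2 : weight f (cs1 ++ cs2) = weight f cs1 + weight f cs2.
Proof. exact: big_cat. Qed.

Lemma weight_nil f : weight f [::] = 0.
Proof. exact: big_nil. Qed.

Lemma weight_filter f cs :
  weight f [seq c <- cs | c.2 != 0] = weight f cs.
Proof.
elim: cs => //= -[[p m] psi] cs IHc; case: eqP => /= [->|_].
  rewrite weight_cons -IHc /= -[LHS]add0r; congr (_ + _).
  by rewrite /sqnorm big1 // => B _; rewrite ffunE normr0 expr0n mulr0.
by rewrite !weight_cons IHc.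
Qed.

Definition bit_at (a : option (qubit n w)) B : bool :=
  if a is Some q then q \in B else false.

(** Each basis state survives in exactly one of the two projections, so for quantities diagonal in
    the computational basis a measurement acts as a classical reading of the bit. The branches
    filtered out carry no weight. *)
Lemma weight_measure f p x m a psi :
  weight f [seq c <- [seq (p, set_var m x (nat_of_bool b), project a b psi)
                     | b <- [:: false; true]] | c.2 != 0]
  = sqnorm (fun B =>
      f p (set_var m x (bit_at a B)) B) psi.
Proof.
rewrite weight_filter /= !weight_cons weight_nil addr0 /sqnorm -big_split /=.
apply: eq_bigr => B _; rewrite !ffunE -/(bit_at a B).
by case: (bit_at a B);
  rewrite /= normr0 expr0n /= mulr0 ?add0r ?addr0.
Qed.

Lemma weight1_step c : weight (fun _ _ _ => 1) (step G k c) = sqnorm (fun=> 1) c.2.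
Proof.
case: c => [[[|i p] m] psi] /=.
  by rewrite weight_cons weight_nil addr0.
case: i => [x e|g e|e1 e2|x e|e p1 p2|e p1];
  rewrite ?weight_measure ?weight_cons ?weight_nil ?addr0 //=.
- exact: sqnorm_gate.
- exact: sqnorm_cnot.
Qed.

(** Conservation of probability: gates preserve the norm and a measurement splits its square between
    the outcomes. This gives the output state trace one. *)
Lemma weight1_branches t c :
  weight (fun _ _ _ => 1) (branches t c) = sqnorm (fun=> 1) c.2.
Proof.
elim: t c => [|t IHt] c; first by rewrite weight_cons weight_nil addr0.
rewrite branchesS -weight1_step; elim: (step _ _ _) => //= c' cs IHc.
by rewrite weight_cat weight_cons IHt IHc.
Qed.

Lemma step_neq0 c : c.2 != 0 -> all (fun c' => c'.2 != 0) (step G k c).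
Proof.
case: c => [[[|i p] m] psi] /= nz; first by rewrite nz.
case: i => [x e|g e|e1 e2|x e|e p1 p2|e p1] /=; rewrite ?nz //.
- by rewrite -sqnorm_eq0 sqnorm_gate sqnorm_eq0 nz.
- by rewrite -sqnorm_eq0 sqnorm_cnot sqnorm_eq0 nz.
- exact: (filter_all (fun c' : config => c'.2 != 0)
           [:: (p, _, project _ false psi); (p, _, project _ true psi)]).
Qed.

Lemma branches_neq0 t c : c.2 != 0 -> all (fun c' => c'.2 != 0) (branches t c).
Proof.
elim: t c => [|t IHt] c nz; first by rewrite /= nz.
rewrite branchesS; elim: (step _ _ _) (step_neq0 nz) => //= c' cs IHc.
by move=> /andP[nz' /IHc]; rewrite all_cat IHt.
Qed.

(** * Classical programs, reduced to single basis states *)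

Fixpoint classical (i : cmd) : bool :=
  match i with
  | Assign _ _ | Measure _ _ => true
  | Gate g _ => if g is GateX then true else false
  | CNot _ _ => false
  | If _ p1 p2 => all classical p1 && all classical p2
  | While _ p1 => all classical p1
  end.

(* The action of a classical program on a single computational basis state.
   Gates are taken to be X, and CNOT has a junk value: neither CNOT nor another
   gate occurs in a classical program. *)
Definition cstep (s : seq cmd * (nat -> nat) * {set qubit n w}) :=
  let: (p, m, B) := s in
  let ev := eval G k m in
  let at_ e := qubit_at n w (ev e) in
  if p is i :: p' then
    match i with
    | Assign x e => (p', set_var m x (ev e), B)
    | Gate _ e => (p', m, if at_ e is Some q then flip q B else B)
    | CNot _ _ => (p', m, B)
    | Measure x e =>
        (p', set_var m x (bit_at (at_ e) B), B)
    | If e p1 p2 => ((if ev e != 0%N then p1 else p2) ++ p', m, B)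
    | While e p1 => (if ev e != 0%N then p1 ++ p else p', m, B)
    end
  else s.

Lemma step_classical c : all classical c.1.1 ->
  all (fun c' => all classical c'.1.1) (step G k c).
Proof.
case: c => [[[|i p] m] psi] //= /andP[ci cp].
case: i ci => [x e|g e|e1 e2|x e|e p1 p2|e p1] /=; rewrite ?cp //.
- by move=> _; do 2!case: ifP; rewrite /= ?cp.
- by move=> /andP[c1 c2]; rewrite all_cat cp; case: ifP; rewrite ?c1 ?c2.
- by move=> c1; case: ifP; rewrite ?all_cat /= ?c1 ?cp.
Qed.

Lemma weight_step_classical f p m psi : all classical p ->
  weight f (step G k (p, m, psi))
  = sqnorm (fun B => let s := cstep (p, m, B) in f s.1.1 s.1.2 s.2) psi.
Proof.
case: p => [|i p] /=; first by rewrite weight_cons weight_nil addr0.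
move=> /andP[ci _].
case: i ci => [x e|g e|e1 e2|x e|e p1 p2|e p1] //= ci;
  rewrite ?weight_measure ?weight_cons ?weight_nil ?addr0 //=.
case: g ci => // _; case: qubit_at => [q|] //=; rewrite /sqnorm.
rewrite [RHS](reindex_inj (inv_inj (flipK q))) /=.
by apply: eq_bigr => B _; rewrite ffunE flipK.
Qed.

(** X gates permute the basis states and measurements only read bits, so no interference arises:
    every basis state evolves by [cstep] on its own and keeps its initial squared amplitude. *)
Lemma weight_branches_classical f t p m psi : all classical p ->
  weight f (branches t (p, m, psi))
  = sqnorm (fun B => let s := iter t cstep (p, m, B) in f s.1.1 s.1.2 s.2) psi.
Proof.
elim: t p m psi => [|t IHt] p m psi cp /=.
  by rewrite weight_cons weight_nil addr0.
pose g p m B := let s := iter t cstep (p, m, B) in f s.1.1 s.1.2 s.2.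
transitivity (weight g (step G k (p, m, psi))).
  rewrite -[LHS]/(weight f (branches t.+1 _)) branchesS.
  elim: (step _ _ _) (step_classical (c := (p, m, psi)) cp) => [|].
    by rewrite !weight_nil.
  move=> [[p' m'] psi'] cs IHc /= /andP[cp' /IHc E].
  by rewrite weight_cat weight_cons IHt // E.
rewrite weight_step_classical //; apply: eq_bigr => B _; congr (_ * _).
by rewrite /g -iterS iterSr; case: (cstep _) => [[]].
Qed.

(** The total weight of the unfinished branches can be computed on basis states, where it vanishes.
    An unfinished branch with nonzero state would contribute a positive term to it. *)
Lemma classical_halted t p m psi : all classical p -> psi != 0 ->
  (forall B, nilp (iter t cstep (p, m, B)).1.1) ->
  all (@halted R n w) (branches t (p, m, psi)).
Proof.
move=> cp nz hB.
have nz' := branches_neq0 t (c := (p, m, psi)) nz.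
have /esym : weight (fun p _ _ => (~~ nilp p)%:R) (branches t (p, m, psi)) = 0.
  rewrite weight_branches_classical // /sqnorm big1 // => B _.
  by rewrite hB mul0r.
have sq_ge0 p' psi' : 0 <= sqnorm (fun=> (~~ nilp p')%:R) psi'.
  by apply: sumr_ge0 => B _; rewrite mulr_ge0 ?ler0n ?exprn_ge0.
elim: (branches _ _) nz' => //= c cs IHc /andP[nzc nzcs] /eqP.
rewrite eq_sym weight_cons paddr_eq0 ?sq_ge0 ?sumr_ge0 //.
move=> /andP[hc /eqP hcs]; rewrite IHc // andbT /halted.
by apply: contraLR hc => /negbTE ->; rewrite /= sqnorm_eq0.
Qed.

End Execution.

Arguments branches : simpl never.

(** * Extending a measured set by a vertex *)

Section Extension.
Local Open Scope nat_scope.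

(* Variables: 0 = candidate vertex, 1 = success flag, 2 = "the candidate may
   still be added", 3 = vertex of the measured set, 4 = measured bit. *)
Definition check_body : seq cmd :=
  [:: Measure 4 (Var 3);
      Assign 2 (Defs.Sub (Var 2) (Defs.Sub (Var 4) (InputEdge (Var 3) (Var 0))));
      Assign 3 (Add (Var 3) (Cst 1))].

Definition check_loop : cmd := While (Defs.Sub InputN (Var 3)) check_body.

Definition search_body : seq cmd :=
  [:: Assign 2 (Defs.Sub (Cst 1) (Var 1));
      Assign 3 (Cst 0);
      check_loop;
      If (Var 2) [:: Gate GateX (Var 0)] [:: Assign 4 (Cst 0)];
      Assign 1 (Add (Var 1) (Var 2));
      Assign 0 (Add (Var 0) (Cst 1))].

Definition search_loop : cmd := While (Defs.Sub InputN (Var 0)) search_body.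

Definition extension : seq cmd :=
  [:: Assign 0 (Cst 0); Assign 1 (Cst 0); search_loop].

(* Exact for every state and measurement outcome: the search goes on idly after
   a success, and the two branches of the If have equal length. *)
Definition extension_time (n : nat) : nat := 2 + ((4 * n + 8) * n + 1).

Variables (n w : nat) (G : {set {set 'I_n}}) (k : nat).
Local Notation cstep := (@cstep n w G k).
Implicit Types (m : nat -> nat) (B : {set qubit n w}).

Definition output_set B : {set 'I_n} := [set u | inl u \in B].

Definition adjacent_to_all (A : {set 'I_n}) (v : 'I_n) : bool :=
  [forall u in A, [set u; v] \in G].

Lemma edge_queryE (u v : 'I_n) : edge_query G u v = ([set u; v] \in G).
Proof.
congr nat_of_bool; apply/existsP/idP => [[x /existsP[y]]|uv].
  by case/and3P=> /eqP/val_inj-> /eqP/val_inj->.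
by exists u; apply/existsP; exists v; rewrite !eqxx.
Qed.

Lemma qubit_at_output (u : 'I_n) : qubit_at n w u = Some (inl u).
Proof.
rewrite /qubit_at insubT; first exact: ltn_addr.
move=> lt_u /=; congr Some.
have -> : Sub (nat_of_ord u) lt_u = unsplit (inl u) :> 'I_(n + w) by apply: val_inj.
by rewrite unsplitK.
Qed.

(** Here [r] counts the vertices still to be read. A pass costs four steps, the loop test and three
    instructions, and one last test leaves the loop. By truncated subtraction, variable 2 drops to 0
    exactly when a vertex of the set is not adjacent to the candidate. *)
Lemma check_loop_run r p m B : m 3 + r = n -> m 0 < n -> m 2 <= 1 ->
  exists2 m', iter (4 * r + 1) cstep (check_loop :: p, m, B) = (p, m', B) &
    [/\ m' 0 = m 0, m' 1 = m 1 &
        m' 2 = (m 2 != 0) && [forall u : 'I_n, (m 3 <= u) ==>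
          (u \in output_set B) ==> (edge_query G u (m 0) != 0)]].
Proof.
elim: r m => [|r IHr] m mr m0 m2.
  exists m; first by rewrite muln0 /= (_ : n - m 3 = 0) //; lia.
  split=> //; have -> : [forall u : 'I_n, (m 3 <= u) ==>
          (u \in output_set B) ==> (edge_query G u (m 0) != 0)] = true.
    by apply/forallP=> u; apply/implyP=> le_u; have := ltn_ord u; lia.
  by rewrite andbT; case: (m 2) m2 => [|[]].
have m3 : m 3 < n by lia.
pose u := Ordinal m3.
have -> : 4 * r.+1 + 1 = (4 * r + 1) + 4 by lia.
rewrite iterD /= subn_eq0 -ltnNge m3 /=.
rewrite [qubit_at _ _ _](qubit_at_output u) /=.
set m1 := set_var _ 3 _.
have [| | |m' -> [e0 e1 e2]] := IHr m1; rewrite /m1 /set_var //=; first lia.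
  lia.
exists m' => //; split=> //; rewrite {}e2 /m1 /set_var /=; congr nat_of_bool.
transitivity ((m 2 != 0) && ((inl u \in B) ==> (edge_query G u (m 0) != 0)) &&
  [forall u0 : 'I_n, (m 3 + 1 <= u0) ==>
    (u0 \in output_set B) ==> (edge_query G u0 (m 0) != 0)]).
  congr (_ && _); rewrite /=; case: (inl u \in B); rewrite /edge_query;
    by case: [exists _, _]; rewrite /= ?subn0 ?subnn ?andbT //; lia.
rewrite -andbA; congr (_ && _).
apply/andP/forallP => [[hu /forallP h] x|h].
  apply/implyP; rewrite leq_eqVlt => /orP[/eqP ux|lt_x].
    by have <- : u = x by [apply: val_inj]; rewrite inE.
  by have := h x; rewrite addn1 lt_x.
split; first by have := h u; rewrite leqnn inE.
by apply/forallP=> x; apply/implyP=> lt_x; have := h x; rewrite ltnW // -addn1.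
Qed.

(** [Q] is the property wanted of the final basis state, kept abstract so that the vertex found need
    not be named. Once flag 1 is set, variable 2 starts every later pass at 0 and no further qubit
    is flipped. *)
Lemma search_loop_run (Q : {set qubit n w} -> Prop) r m B :
  m 0 + r = n -> m 1 <= 1 ->
  (m 1 = 1 -> Q B) ->
  (m 1 = 0 -> forall v : 'I_n, m 0 <= v -> adjacent_to_all (output_set B) v ->
     Q (flip (inl v) B)) ->
  exists m' B', iter ((4 * n + 8) * r + 1) cstep ([:: search_loop], m, B)
    = ([::], m', B') /\
    (m 1 = 1 \/ [exists v : 'I_n, (m 0 <= v) && adjacent_to_all (output_set B) v]
     -> Q B').
Proof.
elim: r m B => [|r IHr] m B mr m1 Q1 Q0.
  exists m, B; split; first by rewrite muln0 /= (_ : n - m 0 = 0) //; lia.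
  case=> // /existsP[v /andP[]]; have := ltn_ord v; lia.
have m0 : m 0 < n by lia.
pose v := Ordinal m0.
(* One pass: three steps for the loop test and two assignments, then [check_loop], then four steps
   for the [If], its one-instruction branch and two assignments. *)
have -> : (4 * n + 8) * r.+1 + 1 = ((4 * n + 8) * r + 1) + (4 + ((4 * n + 1) + 3))
  by lia.
rewrite iterD (iterD 4) (iterD (4 * n + 1) 3) /= subn_eq0 -ltnNge m0 /=.
set m2 := set_var _ 3 _.
have [| | |m' -> [e0 e1 e2]] :=
  @check_loop_run n (drop 3 search_body ++ [:: search_loop]) m2 B.
- by rewrite /m2 /set_var.
- by rewrite /m2 /set_var.
- by rewrite /m2 /set_var /=; lia.
rewrite {}/m2 /set_var /= in e0 e1 e2.
have {}e2 : m' 2 = (m 1 == 0) && adjacent_to_all (output_set B) v.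
  rewrite e2; congr (nat_of_bool (_ && _)); first by case: (m 1) m1 => [|[]].
  apply: eq_forallb => u; rewrite -[X in edge_query _ _ X]/(val v) edge_queryE.
  by rewrite eqb0 negbK.
rewrite /=.
have [ok|nok] := boolP ((m 1 == 0) && adjacent_to_all (output_set B) v).
  rewrite ok in e2; case/andP: ok => /eqP z1 adj.
  rewrite !e2 /= !e0 [qubit_at _ _ _](qubit_at_output v).
  set B1 := flip _ _; set m3 := set_var _ 0 _.
  have [| | | |m4 [B4 [-> hQ]]] := IHr m3 B1;
    rewrite /m3 /set_var /= ?e0 ?e1 ?e2 ?z1 //=; first lia.
  - by move=> _; apply: Q0.
  exists m4, B4; split=> // _; apply: hQ; left.
  by rewrite /m3 /set_var /= e1 e2 z1.
rewrite (negbTE nok) in e2.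
rewrite !e2 /=; set m3 := set_var _ 0 _.
have [| | | |m4 [B4 [-> hQ]]] := IHr m3 B; rewrite /m3 /set_var /= ?e0 ?e1 ?e2 ?addn0 //=.
- lia.
- by move=> z1 x le_x; apply: Q0 => //; lia.
exists m4, B4; split=> // -[z1|/existsP[x /andP[le_x adj]]]; apply: hQ.
  by left; rewrite /m3 /set_var /= e1 e2 addn0.
rewrite /m3 /set_var /= e0 e1 e2 addn0.
case: (m 1) m1 nok => [|[]] //= _ nok; [right|by left].
apply/existsP; exists x; rewrite adj andbT addn1 ltn_neqAle le_x andbT.
by apply: contra nok => /eqP vx; have -> : v = x by apply: val_inj.
Qed.

End Extension.

Arguments extension_time : simpl never.

(** * The extended algorithm *)

Definition extendable (n k : nat) (G : {set {set 'I_n}}) (S : {set 'I_n}) : bool :=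
  (#|S|.+1 == k) && [exists v, kclique k G (v |: S)].

Lemma extension_run (n w : nat) (G : {set {set 'I_n}}) (k : nat) m
    (B : {set qubit n w}) : exists m' B',
  iter (extension_time n) (cstep G k) (extension, m, B) = ([::], m', B') /\
  forall Q : {set qubit n w} -> Prop,
  (forall v, adjacent_to_all G (output_set B) v -> Q (flip (inl v) B)) ->
  (exists v, adjacent_to_all G (output_set B) v) -> Q B'.
Proof.
pose m0 := set_var (set_var m 0 0) 1 0.
pose Q0 B' := forall Q : {set qubit n w} -> Prop,
  (forall v, adjacent_to_all G (output_set B) v -> Q (flip (inl v) B)) -> Q B'.
have [| | | |m' [B' [hrun hQ]]] := @search_loop_run n w G k Q0 n m0 B;
  rewrite /m0 /set_var //=.
  by move=> _ v _ adj Q; apply.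
have E : iter (extension_time n) (cstep G k) (extension, m, B) = ([::], m', B').
  have -> : extension_time n = (((4 * n + 8) * n + 1) + 2)%N by rewrite addnC.
  by rewrite iterD.
exists m', B'; split=> //.
move=> Q hv [v adj]; apply: hQ hv; right.
by apply/existsP; exists v; rewrite adj.
Qed.

(** The vertex found may differ from the witness of [extendable]. It serves equally well, since the
    measured set is a clique, being part of one, and the new vertex is adjacent to all of it. *)
Lemma extension_kclique (n w : nat) (G : {set {set 'I_n}}) (k : nat) m
    (B : {set qubit n w}) : is_graph G -> extendable k G (output_set B) ->
  kclique k G (output_set (iter (extension_time n) (cstep G k) (extension, m, B)).2).
Proof.
move=> gG /andP[/eqP cS /existsP[x /andP[/eqP cx clx]]].
have [m' [B' [-> hQ]]] := extension_run G k m B.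
apply: (hQ (fun B => kclique k G (output_set B))); last first.
  exists x; apply/forall_inP=> u uS.
  have /forall_inP/(_ u (setU1r _ uS))/forall_inP/(_ x (setU11 _ _)) := clx.
  move=> /implyP; apply.
  apply: contra_eq_neq cx => ux; rewrite -ux (setUidPr _) ?sub1set // -cS.
  by rewrite neq_ltn ltnSn.
move=> v /forall_inP adj.
(* A graph has no loops, so a vertex adjacent to the whole set lies outside it and the flip adds
   it. *)
have loop u : [set u; u] \notin G.
  by apply/negP => /(subsetP gG); rewrite inE setUid cards1.
have vS : inl v \notin B.
  by apply/negP => vB; have := adj v; rewrite inE vB (negbTE (loop v)) => /(_ isT).
have -> : output_set (flip (inl v) B) = v |: output_set B.
  by apply/setP => u; rewrite /flip (negbTE vS) !inE.
rewrite /kclique cardsU1 [v \in _]inE vS add1n cS eqxx /=.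
apply/forall_inP => u /setU1P uS; apply/forall_inP => u' /setU1P uS'.
apply/implyP => uu'; case: uS uS' uu' => [->|uS] [->|uS']; rewrite ?eqxx // => uu'.
- by rewrite setUC; apply: adj.
- exact: adj.
have /forall_inP/(_ u (setU1r _ uS))/forall_inP/(_ u' (setU1r _ uS')) := clx.
by rewrite uu'.
Qed.

Section ExtendedAlgorithm.
Variable R : realType.
Variable A : poly_quantum_alg R.

Let prog : seq cmd := alg_prog A ++ extension.

Lemma ket0_sqnorm n w : sqnorm (fun=> 1) (ket0 R n w) = 1.
Proof.
rewrite /sqnorm (bigD1 set0) //= big1 => [|B /negbTE B0];
  by rewrite ffunE ?eqxx ?B0 ?normr0 ?normr1 ?expr1n ?expr0n ?mulr1 ?mulr0 ?addr0.
Qed.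

Lemma ket0_neq0 n w : ket0 R n w != 0.
Proof. by rewrite -sqnorm_eq0 ket0_sqnorm oner_eq0. Qed.

Lemma extension_halted n w (G : {set {set 'I_n}}) k m (psi : qstate R n w) :
  psi != 0 -> all (@halted R n w) (branches G k (extension_time n) (extension, m, psi)).
Proof.
move=> nz; apply: classical_halted => // B.
by have [m' [B' [-> _]]] := extension_run G k m B.
Qed.

(** The slack 20 is generous: its additive part absorbs the cases [n = 0] and [n = 1], where the
    extension takes 3 and 15 steps, and its exponent dominates the quadratic time from [n = 2]
    on. *)
Lemma polybound_extension d n :
  (polybound d n + extension_time n <= polybound (d + 20) n)%N.
Proof.
rewrite /polybound /extension_time expnD.
case: n => [|[|n]].
- have : (0 ^ d <= 1)%N by case: d => // d; rewrite exp0n.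
  by rewrite (exp0n (n := 20)) // muln0 muln0; lia.
- by rewrite !exp1n; lia.
have h1 : (0 < n.+2 ^ d)%N by rewrite expn_gt0.
have h2 : ((4 * n.+2 + 8) * n.+2 <= n.+2 ^ 20)%N.
  have -> : (n.+2 ^ 20 = n.+2 ^ 18 * n.+2 * n.+2)%N by rewrite -!expnSr.
  rewrite leq_mul2r; apply/orP; right.
  have : (2 ^ 3 <= n.+2 ^ 18)%N.
    by rewrite (leq_trans (n := n.+2 ^ 3)) ?leq_exp2r ?leq_exp2l.
  by move: (n.+2 ^ 18)%N => x; nia.
move: (n.+2 ^ d)%N (n.+2 ^ 20)%N h1 h2 => x y; nia.
Qed.

Lemma extended_run n (G : {set {set 'I_n}}) k : is_graph G -> (k <= n)%N ->
  let w := polybound (alg_space A) n in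
  run R w prog G k (polybound (alg_time A + 20) n)
  = flatten [seq branches G k (extension_time n) (append_prog extension c)
            | c <- run R w (alg_prog A) G k (polybound (alg_time A) n)].
Proof.
move=> gG kn w.
rewrite -branches_cat; first last.
- exact/branches_neq0/ket0_neq0.
- exact: alg_halts.
- by move=> m psi; apply: extension_halted.
(* All branches have halted by the sum of the two running times, so the larger bound only adds idle
   steps. *)
rewrite -(subnKC (polybound_extension (alg_time A) n)).
rewrite -[LHS]/(branches G k _ (prog, fun=> 0%N, ket0 R n w)).
rewrite branches_halted_add // branches_cat.
- have := branches_neq0 G k (polybound (alg_time A) n)
    (c := (alg_prog A, fun=> 0%N, ket0 R n w)) (ket0_neq0 n w).
  have := alg_halts A gG kn; rewrite -/w.
  rewrite -[run _ _ _ _ _ _]/(branches G k _ _).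
  elim: (branches G k _ _) => //= -[[p m] psi] cs IHc /andP[h1 h2] /andP[nz1 nz2].
  by rewrite all_cat IHc // andbT; case: p h1 nz1 => // _; apply: extension_halted.
- by move=> m psi; apply: extension_halted.
- exact: alg_halts.
- exact/branches_neq0/ket0_neq0.
Qed.

Lemma extended_halts n k (G : {set {set 'I_n}}) : is_graph G -> (k <= n)%N ->
  all (@halted R n (polybound (alg_space A) n))
    (run R (polybound (alg_space A) n) prog G k (polybound (alg_time A + 20) n)).
Proof.
move=> gG kn; rewrite extended_run //.
have := branches_neq0 G k (polybound (alg_time A) n)
  (c := (alg_prog A, fun=> 0%N, ket0 R n (polybound (alg_space A) n))) (ket0_neq0 _ _).
have := alg_halts A gG kn.
rewrite -[run _ _ _ _ _ _]/(branches G k _ _).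
elim: (branches G k _ _) => //= -[[p m] psi] cs IHc /andP[h1 h2] /andP[nz1 nz2].
by rewrite all_cat IHc // andbT; case: p h1 nz1 => // _; apply: extension_halted.
Qed.

Definition extended_alg : poly_quantum_alg R := PolyQuantumAlg extended_halts.

End ExtendedAlgorithm.

(** * Measurement statistics of the output register *)

Section Output.
Variable R : realType.
Local Notation C := R[i].

Lemma output_set_embed n w (S : {set 'I_n}) (W : {set 'I_w}) :
  output_set (embed S W) = S.
Proof.
apply/setP=> u; rewrite !inE; apply/orP/idP => [[/imsetP[x xS [->]]|/imsetP[x _]]|uS] //.
by left; apply: imset_f.
Qed.

Lemma sum_embed n w (f : {set qubit n w} -> C) :
  \sum_B f B = \sum_(S : {set 'I_n}) \sum_(W : {set 'I_w}) f (embed S W).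
Proof.
rewrite pair_bigA /=.
rewrite (reindex (fun SW : {set 'I_n} * {set 'I_w} => embed SW.1 SW.2)) //=.
exists (fun B => (output_set B, [set v | inr v \in B])) => [[S W] _|B _] /=.
  rewrite output_set_embed; congr pair; apply/setP=> u; rewrite !inE.
  apply/orP/idP => [[/imsetP[x _]|/imsetP[x xW [->]]]|uW] //.
  by right; apply: imset_f.
apply/setP=> -[u|u]; rewrite !inE.
  apply/orP/idP => [[/imsetP[x]|/imsetP[x _]]|uB] //; first by rewrite inE => xB [->].
  by left; apply: imset_f; rewrite inE.
apply/orP/idP => [[/imsetP[x _]|/imsetP[x]]|uB] //; first by rewrite inE => xB [->].
by right; apply: imset_f; rewrite inE.
Qed.

(** A measurement of the output register sees only the diagonal of the reduced state, and there the
    partial trace is a sum of squared amplitudes over the work qubits. *)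
Lemma alg_output_weight (A : poly_quantum_alg R) n (G : {set {set 'I_n}}) k
    (P : pred {set 'I_n}) :
  \sum_(i < basis_size n | P (enum_val i)) alg_output A G k i i
  = weight (fun _ _ B => (P (output_set B))%:R)
      (run R (polybound (alg_space A) n) (alg_prog A) G k (polybound (alg_time A) n)).
Proof.
rewrite /alg_output; set cs := run _ _ _ _ _ _.
under eq_bigr => i _ do rewrite summxE.
rewrite exchange_big /=; apply: eq_bigr => c _.
rewrite /sqnorm sum_embed big_mkcond /=.
rewrite [RHS](reindex (@enum_val _ predT)) /=; last first.
  exact/onW_bij/enum_val_bij.
apply: eq_bigr => i _; rewrite mxE.
under [RHS]eq_bigr => W _ do rewrite output_set_embed.
case: ifP => _; last by rewrite big1 // => W _; rewrite mul0r.
by apply: eq_bigr => W _; rewrite mul1r normCK.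
Qed.

Lemma alg_output_ge0 (A : poly_quantum_alg R) n (G : {set {set 'I_n}}) k i :
  0 <= alg_output A G k i i.
Proof.
rewrite /alg_output summxE sumr_ge0 // => c _; rewrite mxE sumr_ge0 // => W _.
by rewrite -normCK exprn_ge0.
Qed.

Lemma alg_output_trace (A : poly_quantum_alg R) n (G : {set {set 'I_n}}) k :
  \sum_i alg_output A G k i i = 1.
Proof.
rewrite (alg_output_weight _ _ _ predT).
rewrite -[weight _ _]/(weight (fun _ _ _ => 1) (branches G k _ _)).
by rewrite weight1_branches ket0_sqnorm.
Qed.

Lemma find_prob_ge0 (A : poly_quantum_alg R) n (G : {set {set 'I_n}}) k :
  0 <= find_prob A G k.
Proof.
apply: sumr_ge0 => i _; have := alg_output_ge0 A G k i.
by rewrite lecE => /andP[].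
Qed.

(** The extension sends every extendable basis state to a k-clique. Other basis states may end in a
    k-clique too, whence only an inequality. *)
Lemma extended_find_prob (A : poly_quantum_alg R) n (G : {set {set 'I_n}}) k :
  is_graph G -> (k <= n)%N ->
  \sum_(i < basis_size n | extendable k G (enum_val i)) complex.Re (alg_output A G k i i)
  <= find_prob (extended_alg A) G k.
Proof.
move=> gG kn; rewrite /find_prob -!raddf_sum /=.
rewrite (alg_output_weight A G k (extendable k G)).
rewrite (alg_output_weight (extended_alg A) G k (kclique k G)).
have Re_le (x y : C) : x <= y -> complex.Re x <= complex.Re y.
  by rewrite lecE => /andP[].
apply: Re_le.
rewrite [in leRHS]/= extended_run //.
have := alg_halts A gG kn.
elim: (run _ _ _ _ _ _) => [|c cs IHc] /=; first by rewrite !weight_nil.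
case/andP=> hc /IHc le_cs; rewrite weight_cat weight_cons lerD //.
case: c hc => [[[|//] m] psi] _.
rewrite (weight_branches_classical _ _ (fun _ _ B => (kclique k G (output_set B))%:R)) //.
apply: ler_sum => B _; rewrite ler_wpM2r ?exprn_ge0 // ler_nat.
by case: (boolP (extendable _ _ _)) => //= eB; rewrite extension_kclique.
Qed.

End Output.

(** * Trace norm and harmonic states *)

Section TraceNorm.
Local Open Scope sesquilinear_scope.
Variable R : realType.
Local Notation C := R[i].

(** Cauchy-Schwarz for a unit vector [b], obtained by summing $(a_i - s b_i)^2 \ge 0$; the division
    by [2 * s] forces the separate case [s = 0]. *)
Lemma sum_mul_le (I : finType) (a b : I -> C) (s : C) :
  (forall i, 0 <= a i) -> (forall i, 0 <= b i) -> 0 <= s ->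
  \sum_i a i ^+ 2 = s ^+ 2 -> \sum_i b i ^+ 2 = 1 ->
  \sum_i a i * b i <= s.
Proof.
move=> a0 b0 s0 sa sb; have [z|sN0] := eqVneq s 0.
  have /allP h : all (fun i => true ==> (a i ^+ 2 == 0)) (index_enum I).
    rewrite -psumr_eq0; last by move=> i _; rewrite exprn_ge0.
    by rewrite sa z expr0n.
  rewrite z big1 // => i _.
  by have := h i (mem_index_enum _); rewrite expf_eq0 /= => /eqP->; rewrite mul0r.
have s_gt0 : 0 < 2 * s by rewrite mulr_gt0 // lt_neqAle eq_sym sN0.
rewrite -(ler_pM2l s_gt0) mulr_sumr.
have -> : 2 * s * s = \sum_i (a i ^+ 2 + s ^+ 2 * b i ^+ 2).
  by rewrite big_split /= -mulr_sumr sa sb; ring.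
apply: ler_sum => i _; rewrite -subr_ge0.
have -> : a i ^+ 2 + s ^+ 2 * b i ^+ 2 - 2 * s * (a i * b i) = (a i - s * b i) ^+ 2.
  by ring.
rewrite real_exprn_even_ge0 // rpredB ?rpredM ?ger0_real //.
Qed.

(** If [P] diagonalises $M^*M$ and $Q = MP^*$, the columns of [Q] have the singular values as norms,
    and $M = QP$. Cauchy-Schwarz for each [j] bounds $\sum_i |Q_{ij} P_{ji}|$ by the [j]-th singular
    value. *)
Lemma trace_norm_diag m (M : 'M[C]_m) : \sum_i `|M i i| <= trace_norm M.
Proof.
rewrite /trace_norm; set N := M^t* *m M.
have hN : N \is normalmx.
  apply/normalmxP; suff -> : N^t* = N by [].
  by rewrite /N trmx_mul map_mxM /= trmxCK.
set D := spectral_diag N; set P := spectralmx N.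
have Pu : P \is unitarymx := spectral_unitarymx N.
have PP : P^t* *m P = 1%:M.
  by rewrite -invmx_unitary // mulVmx // unitarymx_unit.
have ND : P *m N *m P^t* = diag_mx D.
  rewrite [in LHS](orthomx_spectralP hN) -/P -/D invmx_unitary //.
  by rewrite !mulmxA (unitarymxP Pu) mul1mx -mulmxA (unitarymxP Pu) mulmx1.
set Q := M *m P^t*.
have QQ : Q^t* *m Q = diag_mx D.
  by rewrite -ND /Q trmx_mul map_mxM /= trmxCK /N !mulmxA.
have normQ j : \sum_i `|Q i j| ^+ 2 = D 0 j.
  have /matrixP/(_ j j) := QQ; rewrite !mxE eqxx mulr1n => <-.
  by apply: eq_bigr => i _; rewrite !mxE normCK mulrC.
have normP j : \sum_i `|P j i| ^+ 2 = 1.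
  have /matrixP/(_ j j) := unitarymxP Pu; rewrite !mxE eqxx mulr1n => e; rewrite -[RHS]e.
  by apply: eq_bigr => i _; rewrite !mxE normCK.
have ME i : M i i = \sum_j Q i j * P j i.
  by rewrite -[M in LHS]mulmx1 -PP mulmxA mxE.
apply: (@le_trans _ _ (\sum_i \sum_j `|Q i j| * `|P j i|)).
  apply: ler_sum => i _; rewrite ME; apply: le_trans (ler_norm_sum _ _ _) _.
  by apply: ler_sum => j _; rewrite normrM.
rewrite exchange_big /=; apply: ler_sum => j _.
have D0 : 0 <= D 0 j by rewrite -normQ sumr_ge0 // => i _; rewrite exprn_ge0.
apply: sum_mul_le => //; first by rewrite sqrtC_ge0.
by rewrite sqrtCK.
Qed.

(** The mass [1 - p] that [rho] puts outside [P] appears twice in the diagonal of [rho - T]: as an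
    excess off [P], where [T] has zero diagonal, and as a deficit on [P]. This cancels the factor
    1/2 of the trace distance. *)
Lemma trace_dist_prob m (rho T : 'M[C]_m) (P : pred 'I_m) (tau : R) :
  (forall i, 0 <= rho i i) -> \sum_i rho i i = 1 -> \sum_i T i i = 1 ->
  (forall i, T i i != 0 -> P i) ->
  trace_dist rho T <= real_complex R tau ->
  1 - tau <= \sum_(i | P i) complex.Re (rho i i).
Proof.
move=> rho0 rho1 T1 TP dist.
set p := \sum_(i | P i) rho i i.
have p0 : 0 <= p by apply: sumr_ge0.
suff : real_complex R (1 - tau) <= p by rewrite lecE -raddf_sum => /andP[].
have compl : \sum_(i | ~~ P i) rho i i = 1 - p.
  by have := rho1; rewrite (bigID P) /= -/p => <-; rewrite addrAC subrr add0r.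
have TP1 : \sum_(i | P i) T i i = 1.
  rewrite -T1 [RHS](bigID P) /= [X in _ + X]big1 ?addr0 // => i.
  by apply: contraNeq => /TP.
have h1 : 1 - p <= \sum_(i | P i) `|(rho - T) i i|.
  apply: (@le_trans _ _ `|\sum_(i | P i) (rho - T) i i|); last exact: ler_norm_sum.
  have -> : \sum_(i | P i) (rho - T) i i = p - 1.
    by rewrite -TP1 -sumrB; apply: eq_bigr => i _; rewrite !mxE.
  by rewrite distrC real_ler_norm // rpredB ?rpred1 ?ger0_real.
have h2 : 1 - p <= \sum_(i | ~~ P i) `|(rho - T) i i|.
  rewrite -compl; apply: ler_sum => i nP; rewrite !mxE.
  have -> : T i i = 0 by apply/eqP; apply: contraNT nP => /TP.
  by rewrite subr0 ger0_norm.
have h3 := le_trans (lerD h1 h2) _.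
move/(_ (trace_norm (rho - T))) in h3.
have {}h3 : 1 - p + (1 - p) <= trace_norm (rho - T).
  by apply: h3; rewrite -(bigID P predT (fun i => `|(rho - T) i i|)) /= trace_norm_diag.
have h4 : 1 - p <= trace_dist rho T.
  rewrite /trace_dist -(ler_pM2l (ltr0n C 2)) mulrA divff ?pnatr_eq0 // mul1r.
  by apply: le_trans h3; rewrite mulr_natl mulr2n.
rewrite rmorphB rmorph1 lerBlDr -lerBlDl.
exact: le_trans h4 dist.
Qed.

End TraceNorm.

Lemma sum_neq0 (V : nmodType) (I : finType) (F : I -> V) :
  \sum_i F i != 0 -> exists i, F i != 0.
Proof.
move=> nz; apply/existsP; apply: contraNT nz => /existsPn h.
by rewrite big1 // => i _; apply/eqP; rewrite -[_ == _]negbK h.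
Qed.

(** * Trace and support of the harmonic state *)

Section Harmonic.
Variable R : realType.

(** In a full-rank factorisation $P = CR$, idempotence forces $RC = 1$, and the trace is cyclic. *)
Lemma mxtrace_idempotent (F : fieldType) m (P : 'M[F]_m) :
  P *m P = P -> \tr P = (\rank P)%:R.
Proof.
move=> PP; rewrite -{1}(mulmx_base P) mxtrace_mulC.
suff -> : row_base P *m col_base P = 1%:M by rewrite mxtrace1.
apply: (row_full_inj (col_base_full P)); apply: (row_free_inj (row_base_free P)).
by rewrite mulmx1 /= mulmxA -mulmxA !mulmx_base.
Qed.

Variables (n : nat) (K : {set {set 'I_n}}) (d : nat).

Lemma harmonic_proj_trace : \tr (harmonic_proj R K d) = (betti R K d)%:R.
Proof.
rewrite mxtrace_idempotent; last exact: proj_ortho_proj.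
by rewrite /harmonic_proj proj_orthoE mxrank_map.
Qed.

Lemma harmonic_state_trace : betti R K d != 0%N ->
  \sum_i harmonic_state R K d i i = 1.
Proof.
move=> bN0; rewrite -[LHS]/(\tr _) /harmonic_state mxtraceZ mxtrace_mulC mulmxA.
suff -> : (simplex_ket R K d)^T *m simplex_ket R K d = 1%:M.
  by rewrite mul1mx harmonic_proj_trace mulVf // pnatr_eq0.
apply/matrixP => j j'; rewrite !mxE.
rewrite (bigD1 (enum_rank (enum_val j : {set 'I_n}))) //= big1 ?addr0.
  by rewrite !mxE enum_rankK eqxx mul1r (inj_eq enum_val_inj).
move=> i ij; rewrite !mxE; case: eqP => [e|_]; last by rewrite mul0r.
by rewrite -e enum_valK eqxx in ij.
Qed.

(** The row of the projector at simplex [j] is a complex combination of real rows spanning the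
    kernel. Its [j]-th entry is nonzero, hence so is that of one of these rows, which is the real
    harmonic chain sought. *)
Lemma harmonic_state_support i : harmonic_state R K d i i != 0 ->
  exists (j : 'I_#|simplices K d|) (z : 'cV[R]_#|simplices K d|),
    [/\ enum_val i = enum_val j, laplacian R K d *m z = 0 & z j 0 != 0].
Proof.
rewrite /harmonic_state !mxE mulf_eq0 => /norP[_].
have ketE j : simplex_ket R K d i j != 0 -> enum_val i = enum_val j.
  by rewrite mxE pnatr_eq0 eqb0 negbK => /eqP.
case/sum_neq0 => j; rewrite mxE mulf_eq0 [_^T _ _]mxE => /norP[+ /ketE ij].
case/sum_neq0 => j'; rewrite mulf_eq0 => /norP[/ketE ij'].
have <- : j = j' by apply: enum_val_inj; rewrite -ij.
move=> Pjj; exists j.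
have /submxP[u uE] : (row j (harmonic_proj R K d) <=
    map_mx (real_complex R) (Defs.harmonic R K d))%MS.
  by rewrite (submx_trans (row_sub _ _)) // proj_orthoE.
have : row j (harmonic_proj R K d) 0 j != 0 by rewrite mxE.
rewrite uE mxE => /sum_neq0[r]; rewrite mulf_eq0 mxE => /norP[_ Hrj].
exists (row r (Defs.harmonic R K d))^T; split=> //; last first.
  by rewrite [_^T _ _]mxE [row _ _ _ _]mxE; apply: contraNneq Hrj => ->.
apply: trmx_inj; rewrite trmx_mul trmxK -row_mul /Defs.harmonic mulmx_ker.
by rewrite trmx0; apply/rowP => x; rewrite !mxE.
Qed.

Lemma betti_neq0 (z : 'cV[R]_#|simplices K d|) :
  laplacian R K d *m z = 0 -> z != 0 -> betti R K d != 0%N.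
Proof.
move=> Lz; rewrite /betti mxrank_eq0; apply: contraNneq => H0.
have : (z^T <= Defs.harmonic R K d)%MS.
  by apply/sub_kermxP; rewrite -trmx_mul Lz trmx0.
by rewrite H0 submx0 -trmx0 (inj_eq trmx_inj).
Qed.

(** Pairing with [z] turns the equation into $|\partial_d z|^2 + |\partial_{d+1}^\top z|^2 = 0$. *)
Lemma laplacian_ker (z : 'cV[R]_#|simplices K d|) :
  laplacian R K d *m z = 0 -> boundary R K d *m z = 0.
Proof.
have sq m (y : 'cV[R]_m) : (y^T *m y) 0 0 = \sum_i y i 0 ^+ 2.
  by rewrite mxE; apply: eq_bigr => i _; rewrite !mxE.
have sq_ge0 m (y : 'cV[R]_m) : 0 <= (y^T *m y) 0 0.
  by rewrite sq sumr_ge0 // => i _; rewrite sqr_ge0.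
set D := boundary R K d; set E := boundary R K d.+1 => Lz.
have : ((D *m z)^T *m (D *m z)) 0 0 + ((E^T *m z)^T *m (E^T *m z)) 0 0 = 0.
  have : (z^T *m (laplacian R K d *m z)) 0 0 = 0 by rewrite Lz mulmx0 mxE.
  rewrite /laplacian mulmxDl mulmxDr mxE -/D -/E.
  by rewrite !trmx_mul trmxK !mulmxA.
move/eqP; rewrite paddr_eq0 // => /andP[/eqP + _]; rewrite sq => D0.
apply/matrixP => i j; rewrite (ord1 j) [RHS]mxE; apply/eqP.
rewrite -sqrf_eq0; have /allP/(_ i (mem_index_enum _)) :
    all (fun i => true ==> ((D *m z) i 0 ^+ 2 == 0)) (index_enum 'I_#|simplices K d.-1|).
  by rewrite -psumr_eq0 ?D0 // => x _; rewrite sqr_ge0.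
by [].
Qed.

End Harmonic.

(** * Cycles in the clique complex *)

Section Cliques.
Variables (n : nat) (G : {set {set 'I_n}}).
Implicit Types S T : {set 'I_n}.

Lemma cliqueP S :
  reflect {in S &, forall u v, u != v -> [set u; v] \in G} (clique G S).
Proof.
apply: (iffP forall_inP) => [h u v uS vS uv|h u uS].
  by have /forall_inP/(_ v vS) := h u uS; rewrite uv.
by apply/forall_inP => v vS; apply/implyP; apply: h.
Qed.

Lemma sub_clique S T : T \subset S -> clique G S -> clique G T.
Proof.
move=> /subsetP TS /cliqueP cS; apply/cliqueP => u v /TS uS /TS vS.
exact: cS.
Qed.

Lemma mem_simplices d e T : (e <= d)%N ->
  (T \in simplices (skel d (clique_complex G)) e) = (#|T| == e.+1) && clique G T.
Proof.
move=> ed; rewrite !inE; case: (#|T| =P e.+1) => [cT|_]; last by rewrite andbF.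
by rewrite cT ltnS ed -card_gt0 cT /= !andbT.
Qed.

End Cliques.

Section Cycles.
Variables (R : realType) (n : nat) (G : {set {set 'I_n}}) (k : nat).
Hypothesis k_ge3 : (2 < k)%N.
Implicit Types S T : {set 'I_n}.

Let K := skel (k - 2) (clique_complex G).
Let d := (k - 2)%N.

Definition vertex_sign (T : {set 'I_n}) (v : 'I_n) : R :=
  (-1) ^+ #|[set u in T | (u < v)%N]|.

Lemma setD1_inj S : {in S &, injective (fun v => S :\ v)}.
Proof.
move=> u v uS vS /setP/(_ u); rewrite !inE uS eqxx andbT /=.
by case: eqP.
Qed.

Lemma sum_facet T v (f : 'I_n -> R) : v \in T ->
  \sum_(u in T | T :\ u == T :\ v) f u = f v.
Proof.
move=> vT; rewrite (big_pred1 v) // => u /=; apply/andP/eqP => [[uT /eqP e]|->//].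
exact: setD1_inj e.
Qed.

Lemma boundary_entry_neq0 (i : 'I_#|simplices K d.-1|) (j : 'I_#|simplices K d|) :
  boundary R K d i j != 0 ->
  exists2 u, u \in (enum_val j : {set 'I_n}) & enum_val j :\ u = enum_val i.
Proof.
rewrite mxE => nz.
suff /exists_inP[u uT /eqP] : [exists u in (enum_val j : {set 'I_n}),
  enum_val j :\ u == enum_val i] by exists u.
apply: contraNT nz => /exists_inPn h.
by apply/eqP/big1 => u /andP[uT e]; case/negP: (h u uT).
Qed.

(** At the facet [S :\ v] the simplex [S] contributes a nonzero term to the boundary of [z], so
    another simplex containing this facet must cancel it. The bound [k_ge3] makes [d] positive, so
    that [d.-1] is a true predecessor. *)
Lemma cycle_neighbours (z : 'cV[R]_#|simplices K d|) j v :
  boundary R K d *m z = 0 -> z j 0 != 0 -> v \in (enum_val j : {set 'I_n}) ->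
  exists2 u, u \notin (enum_val j : {set 'I_n}) &
    clique G (u |: (enum_val j :\ v)).
Proof.
move=> dz zj vS; set S : {set 'I_n} := enum_val j in vS *.
have: S \in simplices K d := enum_valP j.
rewrite mem_simplices // => /andP[/eqP cS clS].
have Ti : S :\ v \in simplices K d.-1.
  rewrite mem_simplices ?leq_pred // (sub_clique _ clS) ?subD1set // andbT.
  by have := cardsD1 v S; rewrite vS cS /d; lia.
pose i := enum_rank_in Ti (S :\ v).
have iE : enum_val i = S :\ v by rewrite enum_rankK_in.
have /matrixP/(_ i 0) := dz; rewrite !mxE (bigD1 j) //=.
have -> : boundary R K d i j = vertex_sign S v.
  by rewrite mxE iE; apply: sum_facet.
move=> e0; have : \sum_(j' | j' != j) boundary R K d i j' * z j' 0 != 0.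
  apply: contraTneq isT => s0; move: e0; rewrite s0 addr0 => /eqP.
  by rewrite mulf_eq0 (negbTE zj) signr_eq0.
rewrite big_mkcond => /sum_neq0[j']; case: ifP => [jj'|]; last by rewrite eqxx.
rewrite mulf_eq0 => /norP[/boundary_entry_neq0[u uT TE] _].
rewrite iE in TE; exists u; last first.
  rewrite -TE setD1K //.
  by have := enum_valP j'; rewrite mem_simplices // => /andP[].
apply: contra jj' => uS; apply/eqP/enum_val_inj; rewrite -(setD1K uT) TE -/S.
suff -> : u = v by rewrite setD1K.
apply: contraTeq isT => uv; have : u \in S :\ v by rewrite !inE uv.
by rewrite -TE setD11.
Qed.

(** The sign rule behind $\partial\partial = 0$: removing the smaller vertex shifts the position of
    the larger by one, while removing the larger leaves the smaller in place. *)
Lemma vertex_sign_swap S a b : a \in S -> b \in S -> a != b ->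
  vertex_sign S a * vertex_sign (S :\ a) b
  = - (vertex_sign S b * vertex_sign (S :\ b) a).
Proof.
wlog lt_ab : a b / (a < b)%N => [wl|] aS bS ab.
  case: (ltngtP a b) => [lt|lt|/val_inj e]; last by rewrite e eqxx in ab.
    exact: wl.
  by rewrite (wl b a) ?opprK // eq_sym.
have -> : vertex_sign (S :\ b) a = vertex_sign S a.
  congr (_ ^+ #|pred_of_set _|); apply/setP => u; rewrite !inE.
  case: (u =P b) => [->|//] /=.
  by rewrite [(b < a)%N]ltnNge (ltnW lt_ab) andbF.
have -> : vertex_sign S b = - vertex_sign (S :\ a) b.
  rewrite /vertex_sign (cardsD1 a) inE aS lt_ab exprS mulN1r.
  congr (- _ ^+ #|pred_of_set _|); apply/setP => u; rewrite !inE.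
  by rewrite andbA.
by rewrite mulNr opprK mulrC.
Qed.

(** The skeleton omits [S] itself but keeps its facets, so the boundary of [S] is a nonzero cycle of
    dimension [d]. *)
Lemma betti_planted S : clique G S -> #|S| = k -> betti R K d != 0%N.
Proof.
move=> clS cS.
have facet v : v \in S -> S :\ v \in simplices K d.
  move=> vS; rewrite mem_simplices // (sub_clique _ clS) ?subD1set // andbT.
  by have := cardsD1 v S; rewrite vS cS /d; lia.
(* The boundary of the simplex S. *)
pose z : 'cV[R]_#|simplices K d| :=
  \col_j \sum_(v in S | S :\ v == enum_val j) vertex_sign S v.
apply: (@betti_neq0 R n K d z); last first.
  have /card_gt0P[v vS] : (0 < #|S|)%N by lia.
  apply: contraTneq isT => /colP/(_ (enum_rank_in (facet v vS) (S :\ v))).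
  rewrite !mxE enum_rankK_in ?facet // sum_facet // => /eqP.
  by rewrite signr_eq0.
rewrite /laplacian mulmxDl -!mulmxA.
have -> : boundary R K d *m z = 0; last first.
  rewrite mulmx0 add0r; have -> : boundary R K d.+1 = 0; last by rewrite mul0mx.
  apply/matrixP => i j; have := enum_valP j; rewrite !inE => /andP[/andP[_]].
  by rewrite -/d => le /eqP e; rewrite e ltnn in le.
apply/colP => i; rewrite !mxE.
set s : {set 'I_n} := enum_val i.
pose f a b := vertex_sign S a * vertex_sign (S :\ a) b.
pose Pr a b := [&& a \in S, b \in S, a != b & (S :\ a) :\ b == s].
(* The double boundary becomes a sum over ordered pairs of removed vertices; exchanging the two
   negates it. *)
transitivity (\sum_a \sum_(b | Pr a b) f a b).
  transitivity (\sum_(j : 'I_#|simplices K d|) \sum_(a in S | S :\ a == enum_val j)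
     \sum_(b | Pr a b) f a b).
    apply: eq_bigr => j _; rewrite !mxE mulr_sumr; apply: eq_bigr => a /andP[aS /eqP aj].
    rewrite mulrC /f -mulr_sumr; congr (_ * _); rewrite -aj; apply: eq_bigl => b.
    by rewrite /Pr aS [a == b]eq_sym in_setD1; case: (b == a); case: (b \in S).
  under eq_bigr => j _ do rewrite big_mkcondr.
  rewrite exchange_big /= [RHS](bigID (mem S)) /= [X in _ + X]big1 ?addr0; last first.
    by move=> a /negbTE aS; rewrite big_pred0 // => b; rewrite /Pr aS.
  apply: eq_bigr => a aS.
  rewrite -big_mkcond (big_pred1 (enum_rank_in (facet a aS) (S :\ a))) // => j /=.
  apply/eqP/eqP => [e|->]; last by rewrite enum_rankK_in ?facet.
  by apply: enum_val_inj; rewrite enum_rankK_in ?facet.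
set X := \sum_a _; have XN : X = - X.
  rewrite {1}/X (exchange_big_dep predT) //= /X -sumrN; apply: eq_bigr => b _.
  rewrite -sumrN; apply: eq_big => a.
    rewrite /Pr [a == b]eq_sym andbCA; congr [&& _, _, _ & _ == s].
    by apply/setP=> u; rewrite !inE andbCA.
  by case/and4P=> aS bS ab _; apply: vertex_sign_swap.
by apply/eqP; rewrite -[_ == _](mulrn_eq0 X 2) mulr2n {1}XN addNr.
Qed.

End Cycles.

(** The bad outcomes of the measurement: (k-1)-cliques in no k-clique that still pass the test met
    by every simplex in the support of a cycle. *)
Definition obstructed (n k : nat) (G : {set {set 'I_n}}) (S : {set 'I_n}) : bool :=
  [&& #|S|.+1 == k, clique G S, ~~ extendable k G S &
   [forall v in S, exists u, (u \notin S) && clique G (u |: (S :\ v))]].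

Lemma target_state_support (R : realType) (n k : nat) (G : {set {set 'I_n}}) i :
  (2 < k)%N -> target_state R G k i i != 0 ->
  ~~ obstructed k G (enum_val i) -> extendable k G (enum_val i).
Proof.
move=> k3 /harmonic_state_support[j [z [-> /laplacian_ker dz zj]]].
rewrite /obstructed; have := enum_valP j; rewrite mem_simplices //.
move=> /andP[/eqP cj ->].
rewrite cj -subSn 1?ltnW // subSS subn1 prednK ?(ltn_trans _ k3) //.
rewrite eqxx /=; case: extendable => //= /negP[].
apply/forall_inP => v /(cycle_neighbours k3 dz zj)[u uS clu].
by apply/existsP; exists u; rewrite uS.
Qed.

(** The k-clique of [G] makes the Betti number nonzero, so the target has trace one; without
    obstructions its diagonal is supported on extendable sets. *)
Lemma prepares_find_prob (R : realType) (A : poly_quantum_alg R) (tau : R)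
    (n k : nat) (G : {set {set 'I_n}}) :
  (2 < k)%N -> (k <= n)%N -> is_graph G -> (exists S, kclique k G S) ->
  [forall S, ~~ obstructed k G S] -> prepares_target A tau G k ->
  1 - tau <= find_prob (extended_alg A) G k.
Proof.
move=> k3 kn gG [S /andP[/eqP cS clS]] /forallP nob prep.
apply: le_trans (extended_find_prob A gG kn).
apply: (trace_dist_prob (T := target_state R G k)) => //.
- exact: alg_output_ge0.
- exact: alg_output_trace.
- exact/harmonic_state_trace/(betti_planted R k3 clS cS).
- by move=> i /(target_state_support k3); apply.
Qed.

(** * Obstructions and random graphs *)

Section Counting.
Local Open Scope nat_scope.

Lemma bin_leq_expn a b : 'C(a, b) <= a ^ b.
Proof.
elim: b a => [|b IHb] a; first by rewrite bin0.
rewrite expnS; apply: (@leq_trans (b.+1 * 'C(a, b.+1))); first by rewrite leq_pmull.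
rewrite -mul_bin_diag leq_mul2l (leq_trans (IHb _)) ?orbT //.
by case: b {IHb} => // b; rewrite leq_exp2r // leq_pred.
Qed.

(** The difference equals $j(a + k - 2)/2$. *)
Lemma bin2_diff_ge a j k : a + j = k.-1 ->
  j * (k - 2)./2 <= 'C(k.-1, 2) - 'C(a, 2).
Proof.
have f x : 2 * 'C(x, 2) = x * x.-1 by rewrite -mul_bin_diag bin1.
move=> e; have := f a; have := f k.-1; rewrite -e.
have [->|j_gt0] := posnP j; first by rewrite mul0n.
have : 2 * (k - 2)./2 <= a + j - 1 by lia.
move: ('C(a + j, 2)) ('C(a, 2)) (_./2) => x y h; nia.
Qed.

End Counting.

(** * Edges that an obstruction forces outside the planted clique *)

Section Obstructions.
Variables (n k m : nat) (G : {set {set 'I_n}}) (S : {set 'I_n}).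
Implicit Types T W Z : {set 'I_n}.

Definition outer_edges T : {set {set 'I_n}} :=
  [set e in vpairs n | (e \subset T) && ~~ (e \subset S)].

Definition cross_edges W Z : {set {set 'I_n}} :=
  [set [set p.1; p.2] | p in setX W Z].

Lemma plant_edge u v : u != v ->
  ([set u; v] \in plant G S)
  = ([set u; v] \in G) || (u \in S) && (v \in S).
Proof. by move=> uv; rewrite !inE cards2 uv subUset !sub1set. Qed.

Lemma exists_subset_card (A : {set 'I_n}) a :
  (a <= #|A|)%N -> exists2 B : {set 'I_n}, B \subset A & #|B| = a.
Proof.
rewrite -bin_gt0 -cards_draws => /card_gt0P[B]; rewrite inE => /andP[BA /eqP cB].
by exists B.
Qed.

Lemma obstruction_cases T : (2 * m <= k)%N -> #|S| = k ->
  obstructed k (plant G S) T ->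
  [exists T : {set 'I_n}, [&& #|T| == k.-1, (m <= #|T :\: S|)%N
     & outer_edges T \subset G]] ||
  [exists W : {set 'I_n}, exists Z : {set 'I_n},
     [&& #|W| == m, #|Z| == k - 2 * m, [disjoint W & S], Z \subset S
       & cross_edges W Z \subset G]]%N.
Proof.
move=> mk cS /and4P[/eqP cT clT /negP next /forall_inP nb].
have [mT|mT] := leqP m #|T :\: S|.
  apply/orP; left; apply/existsP; exists T; rewrite -cT eqxx mT /=.
  apply/subsetP => e; rewrite !inE => /and3P[/cards2P[u [v [uv ->]]]].
  rewrite !subUset !sub1set => /andP[uT vT] nS.
  have := cliqueP _ _ clT u v uT vT uv.
  by rewrite plant_edge // (negbTE nS) orbF.
apply/orP; right.
have cTS : (k - m <= #|T :&: S|)%N by have := cardsID S T; lia.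
have [V VT cV] : exists2 V : {set 'I_n}, V \subset T :&: S & #|V| = m.
  by apply: exists_subset_card; lia.
(* Taking [Z] disjoint from [V] ensures that [w v] is adjacent to all of [Z] for every [v] in
   [V]. *)
have [Z ZT cZ] : exists2 Z : {set 'I_n}, Z \subset (T :&: S) :\: V & #|Z| = (k - 2 * m)%N.
  by apply: exists_subset_card; rewrite cardsDS // cV; lia.
pose w v := odflt v [pick u | (u \notin T) && clique (plant G S) (u |: (T :\ v))].
have wP v : v \in T -> w v \notin T /\ clique (plant G S) (w v |: (T :\ v)).
  move=> vT; rewrite /w; case: pickP => [u /andP[]|no] //.
  by have /existsP[u] := nb v vT; rewrite no.
have w_neq v u : v \in T -> u \in T -> w v != u.
  by move=> /wP[wT _] uT; apply: contraNneq wT => ->.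
have w_adj v u : v \in T -> u \in T -> u != v -> [set w v; u] \in plant G S.
  move=> vT uT uv; have [_ /cliqueP cl] := wP v vT.
  by apply: cl; rewrite ?setU11 ?w_neq // !inE uv uT orbT.
have w_nadj v : v \in T -> [set w v; v] \notin plant G S.
  move=> vT; apply/negP => adj; apply: next; rewrite /extendable cT eqxx /=.
  apply/existsP; exists (w v); have [wT _] := wP v vT.
  rewrite /kclique cardsU1 wT add1n cT eqxx /=.
  have wadj u : u \in T -> [set w v; u] \in plant G S.
    by move=> uT; have [->//|uv] := eqVneq u v; apply: w_adj.
  apply/cliqueP => a b /setU1P[->|aT] /setU1P[->|bT] ab.
  - by rewrite eqxx in ab.
  - exact: wadj.
  - by rewrite setUC wadj.
  - exact: (cliqueP _ _ clT).
(* A common value for distinct [v] and [v'] would be adjacent to [v'] through its choice for [v],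
   against [w_nadj]. *)
have w_inj : {in T &, injective w}.
  move=> v v' vT v'T e; apply: contraTeq isT => vv'.
  by have := w_nadj v' v'T; rewrite -e w_adj // eq_sym.
have wS v : v \in T -> v \in S -> w v \notin S.
  move=> vT vS; apply/negP => wvS; have := w_nadj v vT.
  by rewrite plant_edge ?w_neq // wvS vS orbT.
have VT' v : v \in V -> v \in T /\ v \in S.
  by move/(subsetP VT); rewrite inE => /andP.
apply/existsP; exists (w @: V); apply/existsP; exists Z.
rewrite card_in_imset ?cV ?cZ ?eqxx /=; last first.
  by move=> v v' /VT'[vT _] /VT'[v'T _]; apply: w_inj.
apply/and3P; split.
- rewrite disjoint_subset; apply/subsetP => u /imsetP[v /VT'[vT vS] ->].
  by rewrite inE wS.
- by apply: subset_trans ZT _; rewrite subDset subsetU // subsetIr orbT.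
apply/subsetP => e /imsetP[[a z]]; rewrite !inE /= => /andP[/imsetP[v vV ->] zZ] ->.
have [vT vS] := VT' v vV.
have := subsetP ZT z zZ; rewrite !inE => /and3P[zV zT zS].
have zv : z != v by apply: contraNneq zV => ->.
have := w_adj v z vT zT zv.
by rewrite plant_edge ?w_neq // (negbTE (wS v vT vS)) orbF.
Qed.

Lemma card_outer_edges T :
  #|outer_edges T| = ('C(#|T|, 2) - 'C(#|T :&: S|, 2))%N.
Proof.
rewrite -!cards_draws -cardsDS.
  congr #|pred_of_set _|; apply/setP => e; rewrite !inE subsetI.
  by case: (e \subset T); case: (e \subset S); case: (#|e| == 2).
apply/subsetP => e; rewrite !inE subsetI => /andP[/andP[-> _] ->] //.
Qed.

Lemma card_outer_edges_ge T : #|T| = k.-1 ->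
  (#|T :\: S| * (k - 2)./2 <= #|outer_edges T|)%N.
Proof.
move=> cT; rewrite card_outer_edges cT.
by apply: bin2_diff_ge; rewrite -cT -(cardsID S T).
Qed.

(** [S] separates [W] from [Z], so an unordered pair determines its endpoint in each and no edge is
    counted twice. *)
Lemma card_cross_edges W Z : [disjoint W & S] -> Z \subset S ->
  #|cross_edges W Z| = (#|W| * #|Z|)%N.
Proof.
move=> WS ZS; rewrite -cardsX card_in_imset // => -[a b] [a' b'].
rewrite !inE /= => /andP[aW bZ] /andP[aW' bZ'] e.
have nS x : x \in W -> x \notin S.
  by move=> xW; have /disjointFr := WS => ->.
have := subsetP ZS _ bZ; have := subsetP ZS _ bZ' => bS' bS.
have : a \in [set a'; b'] by rewrite -e set21.
have : b \in [set a'; b'] by rewrite -e set22.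
case/set2P => [eb|->]; first by rewrite eb (negbTE (nS a' aW')) in bS.
case/set2P => [->//|ea]; by rewrite -ea (negbTE (nS a aW)) in bS'.
Qed.

Lemma cross_edges_vpairs W Z : [disjoint W & S] -> Z \subset S ->
  cross_edges W Z \subset vpairs n.
Proof.
move=> WS ZS; apply/subsetP => e /imsetP[[a b]]; rewrite !inE /= => /andP[aW bZ] ->.
rewrite cards2; suff -> : a != b by [].
by apply: contraTneq aW => ->; rewrite (disjointFl WS) // (subsetP ZS).
Qed.

End Obstructions.

(** * Probabilities under the uniform and the planted model *)

Section PlantedProbability.
Variables (R : realType) (n : nat).
Implicit Types (P Q : pred {set {set 'I_n}}) (G E : {set {set 'I_n}}).

Definition er_prob P : R := \sum_(G | is_graph G) er_weight R G * (P G)%:R.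

Lemma er_weightE G : er_weight R G = 2^-1 ^+ #|vpairs n|.
Proof.
rewrite /er_weight; under eq_bigr => e _.
  rewrite (_ : 1 - 2^-1 = 2^-1); last by field.
  by rewrite if_same; over.
by rewrite big_const iter_mulr_1.
Qed.

(** All graphs have equal weight, and those containing [E] correspond to the subsets of the
    remaining pairs. *)
Lemma er_prob_superset E : E \subset vpairs n ->
  er_prob (fun G => E \subset G) = 2^-1 ^+ #|E|.
Proof.
move=> EV; rewrite /er_prob.
under eq_bigr => G _ do rewrite er_weightE mulr_natr mulrb.
rewrite -big_mkcondr sumr_const -[X in _ *+ X]/(#|_|).
have -> : #|(fun G => is_graph G && (E \subset G))| = (2 ^ (#|vpairs n| - #|E|))%N.
  rewrite -(cardsDS EV) -card_powerset.
  rewrite -(card_in_imset (f := fun H => E :|: H)); last first.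
    move=> H H'; rewrite !inE !subsetD => /andP[_ d] /andP[_ d'] /setP e.
    apply/setP => x; have := e x; rewrite !inE.
    have [xE _|//] := boolP (x \in E).
    by rewrite (disjointFl d xE) (disjointFl d' xE).
  apply: eq_card => G; rewrite [LHS]unfold_in /=; apply/andP/imsetP => [[gG EG]|[H]].
    exists (G :\: E); first by rewrite inE setSD.
    apply/setP => x; rewrite !inE.
    by have [/(subsetP EG) ->|] := boolP (x \in E).
  rewrite inE => HV ->; rewrite /is_graph subUset EV subsetUl.
  by rewrite (subset_trans HV) ?subsetDl.
have := subnK (subset_leq_card EV); set a := (_ - _)%N => <-.
rewrite -[LHS]mulr_natr natrX exprD.
by rewrite mulrAC -exprMn mulVf ?pnatr_eq0 // expr1n mul1r.
Qed.

Lemma er_prob_le P Q : (forall G, is_graph G -> P G -> Q G) -> er_prob P <= er_prob Q.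
Proof.
move=> PQ; apply: ler_sum => G gG; rewrite ler_wpM2l ?er_weightE ?exprn_ge0 ?invr_ge0 //.
by rewrite ler_nat; have := PQ G gG; case: (P G) (Q G) => [] [] // ->.
Qed.

Lemma er_prob_or P Q : er_prob (fun G => P G || Q G) <= er_prob P + er_prob Q.
Proof.
rewrite /er_prob -big_split /=; apply: ler_sum => G _.
rewrite -mulrDr ler_wpM2l ?er_weightE ?exprn_ge0 ?invr_ge0 //.
by rewrite -natrD ler_nat; case: (P G) (Q G) => [] [].
Qed.

Lemma er_prob_exists (I : finType) (D : pred I) (E : I -> {set {set 'I_n}}) :
  (forall x, D x -> E x \subset vpairs n) ->
  er_prob (fun G => [exists x, D x && (E x \subset G)])
  <= \sum_(x | D x) 2^-1 ^+ #|E x|.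
Proof.
move=> EV; under eq_bigr => x Dx do rewrite -er_prob_superset ?EV //.
rewrite /er_prob exchange_big /=; apply: ler_sum => G _.
rewrite -mulr_sumr ler_wpM2l ?er_weightE ?exprn_ge0 ?invr_ge0 //.
case: existsP => [[x /andP[Dx Ex]]|_]; last by rewrite sumr_ge0.
by rewrite (bigD1 x) //= Ex lerDl sumr_ge0.
Qed.

Lemma planted_prob_le k P (b : R) : 0 <= b ->
  (forall S : {set 'I_n}, #|S| = k -> er_prob (fun G => P (plant G S)) <= b) ->
  planted_prob R k P <= b.
Proof.
move=> b0 Pb; rewrite /planted_prob /planted_expect exchange_big /=.
(* For [k > n] the inverse of 0 is 0, and the planted probability is 0 by convention. *)
have [C0|C_gt0] := posnP 'C(n, k).
  rewrite big1 // => S _; rewrite big1 // => G _.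
  by rewrite C0 invr0 mulr0 mul0r.
apply: (@le_trans _ _ (\sum_(S : {set 'I_n} | #|S| == k) 'C(n, k)%:R^-1 * b)).
  apply: ler_sum => S /eqP cS.
  apply: (@le_trans _ _ ('C(n, k)%:R^-1 * er_prob (fun G => P (plant G S)))).
    by rewrite mulr_sumr; apply: ler_sum => G _; rewrite mulrA [_^-1 * _]mulrC.
  by rewrite ler_wpM2l ?invr_ge0 // Pb.
rewrite -mulr_suml sumr_const.
have -> : #|(fun S : {set 'I_n} => #|S| == k)| = 'C(n, k).
  by rewrite -[n in RHS]card_ord -card_draws; apply: eq_card => A; rewrite inE.
by rewrite -[X in X * b]mulr_natr mulVf ?mul1r // pnatr_eq0 -lt0n.
Qed.
End PlantedProbability.

(** * Union bounds *)

Section UnionBound.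
Variables (R : realType) (n k m : nat) (S : {set 'I_n}).
Hypotheses (cS : #|S| = k) (mk : (2 * m <= k)%N) (k_gt0 : (0 < k)%N).
Local Notation h := (k - 2)./2.
Local Notation q := (n%:R * k%:R / 2 ^+ (k - 2)./2 : R).
Hypothesis q_le1 : q <= 1.

Let k_le_n : (k <= n)%N.
Proof. by rewrite -cS -[n in leqRHS]card_ord max_card. Qed.

Let n_gt0 : (0 < n)%N.
Proof. exact: leq_trans k_gt0 k_le_n. Qed.

Let q_ge0 : 0 <= q.
Proof. by rewrite divr_ge0 ?mulr_ge0 ?exprn_ge0. Qed.

(** [T] is determined by [T :\: S] and [S :\: T]; as [T] has one element fewer than [S], the latter
    has [j.+1] elements. *)
Lemma outer_sets_count (j : nat) :
  (#|[set T : {set 'I_n} | #|T| == k.-1 & #|T :\: S| == j]| <= n ^ j * k ^ j.+1)%N.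
Proof.
pose D := setX [set A : {set 'I_n} | #|A| == j]
  [set A : {set 'I_n} | A \subset S & #|A| == j.+1].
apply: (@leq_trans #|D|); last first.
  rewrite cardsX card_draws cards_draws card_ord cS.
  by rewrite leq_mul ?bin_leq_expn.
rewrite -(card_in_imset (f := fun T : {set 'I_n} => (T :\: S, S :\: T))); last first.
  move=> T T' _ _ [/setP e1 /setP e2]; apply/setP => x.
  have := e1 x; have := e2 x; rewrite !inE.
  by case: (x \in S); rewrite /= ?andbT ?andbF //= => /(congr1 negb); rewrite !negbK.
apply: subset_leq_card; apply/subsetP => p /imsetP[T].
rewrite !inE => /andP[/eqP cT /eqP cj] -> /=.
rewrite cj eqxx subsetDl /=.
have := cardsID S T; have := cardsID T S; rewrite setIC cS cT cj => e1 e2.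
by rewrite -(eqn_add2l #|T :&: S|) e1 addnS e2 prednK.
Qed.

(** Splitting by [j = #|T :\: S|], a class contributes at most $n^j k^{j+1} 2^{-jh} = k q^j \le k
    q^m$, and there are at most [k] classes. *)
Lemma outer_union_bound :
  \sum_(T : {set 'I_n} | (#|T| == k.-1) && (m <= #|T :\: S|)%N)
    2^-1 ^+ #|outer_edges S T| <= k%:R ^+ 2 * q ^+ m.
Proof.
pose D := [pred T : {set 'I_n} | (#|T| == k.-1) && (m <= #|T :\: S|)%N].
have lt_k T : D T -> (#|T :\: S| < k)%N.
  move=> /andP[/eqP cT _]; rewrite -(prednK k_gt0) ltnS -cT.
  by rewrite subset_leq_card ?subsetDl.
pose rk (T : {set 'I_n}) : 'I_k := insubd (Ordinal k_gt0) #|T :\: S|.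
rewrite (partition_big rk predT) //=.
have -> : k%:R ^+ 2 * q ^+ m = \sum_(j < k) k%:R * q ^+ m.
  by rewrite sumr_const card_ord -[RHS]mulr_natl mulrA expr2.
apply: ler_sum => j _.
have [jm|mj] := ltnP j m.
  rewrite big_pred0 ?mulr_ge0 ?exprn_ge0 // => T; apply/negbTE/andP => -[DT /eqP rT].
  have := congr1 val rT; rewrite /rk val_insubd lt_k // => e.
  by move: DT => /andP[_]; rewrite e leqNgt jm.
apply: (@le_trans _ _ (\sum_(T in [set T : {set 'I_n} | #|T| == k.-1 & #|T :\: S| == j])
    2^-1 ^+ (j * h))).
  rewrite [leLHS]big_mkcond [leRHS]big_mkcond; apply: ler_sum => T _ /=.
  case: ifP => [/andP[DT /eqP rT]|_]; last first.
    by case: ifP => // _; rewrite exprn_ge0 ?invr_ge0.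
  have := congr1 val rT; rewrite /rk val_insubd lt_k // => e.
  move: DT => /andP[/eqP cT _]; rewrite inE cT e !eqxx /=.
  by rewrite ler_wiXn2l ?invr_ge0 ?invf_le1 ?ler1n // -e card_outer_edges_ge.
rewrite sumr_const -[leLHS]mulr_natl.
apply: (@le_trans _ _ ((n ^ j * k ^ j.+1)%:R * 2^-1 ^+ (j * h))).
  by rewrite ler_wpM2r ?exprn_ge0 ?invr_ge0 // ler_nat outer_sets_count.
have -> : (n ^ j * k ^ j.+1)%:R * 2^-1 ^+ (j * h) = k%:R * q ^+ j.
  by rewrite natrM !natrX exprS !exprMn mulnC exprM exprVn; ring.
by rewrite ler_wpM2l // ler_wiXn2l.
Qed.

(** There are at most $n^m k^{2m}$ pairs. Since $2h \le k - 2$, the exponent $m(k-2m)$ is at least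
    $2mh - 2m^2$, the loss being the factor $4^{m^2}$. Enlarging $n^m$ to $n^{2m}$ gives $q^{2m} \le
    q^m$. *)
Lemma cross_union_bound :
  \sum_(p : {set 'I_n} * {set 'I_n} | [&& #|p.1| == m, #|p.2| == k - 2 * m,
      [disjoint p.1 & S] & p.2 \subset S]%N)
    2^-1 ^+ #|cross_edges p.1 p.2| <= 4 ^+ (m * m) * q ^+ m.
Proof.
apply: (@le_trans _ _ (\sum_(p in setX [set A : {set 'I_n} | #|A| == m]
      [set A : {set 'I_n} | A \subset S & #|A| == (k - 2 * m)%N])
    2^-1 ^+ (m * (k - 2 * m)))).
  rewrite [leLHS]big_mkcond [leRHS]big_mkcond; apply: ler_sum => p _ /=.
  case: ifP => [/and4P[/eqP c1 /eqP c2 dj sub]|_]; last first.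
    by case: ifP => // _; rewrite exprn_ge0 ?invr_ge0.
  by rewrite !inE c1 c2 sub !eqxx /= (card_cross_edges dj sub) c1 c2.
rewrite sumr_const cardsX card_draws cards_draws card_ord cS -[leLHS]mulr_natl bin_sub //.
apply: (@le_trans _ _ ((n ^ m * k ^ (2 * m))%:R * 2^-1 ^+ (m * (k - 2 * m)))).
  by rewrite ler_wpM2r ?exprn_ge0 ?invr_ge0 // ler_nat leq_mul ?bin_leq_expn.
apply: (@le_trans _ _ (4 ^+ (m * m) * q ^+ (2 * m))); last first.
  by rewrite ler_wpM2l ?exprn_ge0 // ler_wiXn2l // leq_pmull.
have two_h : 2^-1 ^+ (m * (k - 2 * m)) <= 4 ^+ (m * m) * 2^-1 ^+ (h * (2 * m)) :> R.
  have -> : (4 : R) = 2 ^+ 2 by rewrite -natrX.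
  rewrite -exprM exprVn -ler_pdivrMl ?exprn_gt0 // -!exprVn -exprD.
  by rewrite ler_wiXn2l ?invr_ge0 ?invf_le1 ?ler1n //; nia.
apply: le_trans (ler_wpM2l (ler0n _ _) two_h) _.
rewrite mulrCA ler_wpM2l ?exprn_ge0 // [2^-1 ^+ _]exprM exprVn !exprMn natrM !natrX.
rewrite ler_wpM2r ?exprn_ge0 ?invr_ge0 ?exprn_ge0 // ler_wpM2r ?exprn_ge0 //.
by rewrite ler_weXn2l ?ler1n // leq_pmull.
Qed.

Lemma er_prob_obstructed :
  er_prob R (fun G => [exists T, obstructed k (plant G S) T])
  <= (k%:R ^+ 2 + 4 ^+ (m * m)) * q ^+ m.
Proof.
rewrite mulrDl; apply: le_trans (lerD outer_union_bound cross_union_bound).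
apply: le_trans (lerD (er_prob_exists R (D := fun T => _) (E := outer_edges S) _)
  (er_prob_exists R (D := fun p => _) (E := fun p => cross_edges p.1 p.2) _)).
- apply: le_trans (er_prob_or _ _ _); apply: er_prob_le => G gG /existsP[T].
  case/(obstruction_cases mk cS)/orP => [/existsP[T' h]|/existsP[W /existsP[Z h]]].
    by apply/orP; left; apply/existsP; exists T'; rewrite -andbA.
  by apply/orP; right; apply/existsP; exists (W, Z); rewrite -!andbA.
- by move=> T _; apply/subsetP => e; rewrite inE => /andP[].
- by move=> p /and4P[_ _]; apply: cross_edges_vpairs.
Qed.

End UnionBound.

Lemma planted_prob_obstructed (R : realType) (n k m : nat) :
  (2 * m <= k)%N -> (0 < k)%N ->
  (n%:R * k%:R / 2 ^+ (k - 2)./2 : R) <= 1 ->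
  planted_prob R k (fun G : {set {set 'I_n}} => [exists T, obstructed k G T])
  <= (k%:R ^+ 2 + 4 ^+ (m * m)) * (n%:R * k%:R / 2 ^+ (k - 2)./2) ^+ m.
Proof.
move=> mk k_gt0 q_le1; apply: planted_prob_le => [|S cS].
  by rewrite mulr_ge0 ?addr_ge0 ?exprn_ge0 ?divr_ge0 ?mulr_ge0 ?exprn_ge0.
exact: er_prob_obstructed.
Qed.

(** * Expectation and asymptotics *)

Section PlantedExpectation.
Variables (R : realType) (n k : nat).
Implicit Types f g : {set {set 'I_n}} -> R.

Lemma plant_graph (G : {set {set 'I_n}}) S : is_graph G -> is_graph (plant G S).
Proof.
move=> gG; rewrite /is_graph subUset [X in X && _]gG.
by apply/subsetP => e; rewrite inE => /andP[].
Qed.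

Lemma plant_kclique (G : {set {set 'I_n}}) (S : {set 'I_n}) :
  #|S| = k -> kclique k (plant G S) S.
Proof.
move=> cS; rewrite /kclique cS eqxx; apply/cliqueP => u v uS vS uv.
by rewrite plant_edge // uS vS orbT.
Qed.

Lemma planted_expect_le f g :
  (forall G, is_graph G -> (exists S, kclique k G S) -> f G <= g G) ->
  planted_expect k f <= planted_expect k g.
Proof.
move=> fg; apply: ler_sum => G gG; apply: ler_sum => S /eqP cS.
rewrite ler_wpM2l ?divr_ge0 ?er_weightE ?exprn_ge0 ?invr_ge0 //.
by apply: fg; [exact: plant_graph | exists S; apply: plant_kclique].
Qed.

Lemma planted_expectB a f g :
  planted_expect k (fun G => a * (f G - g G))
  = a * (planted_expect k f - planted_expect k g).
Proof.
rewrite /planted_expect -sumrB mulr_sumr; apply: eq_bigr => G _.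
rewrite -sumrB mulr_sumr; apply: eq_bigr => S _; ring.
Qed.

(** The inequality holds graph by graph: on an obstructed graph the left side is at most 0,
    elsewhere [prepares_find_prob] applies. *)
Lemma extended_expectation (A : poly_quantum_alg R) (tau : R) :
  (2 < k)%N -> (k <= n)%N -> tau < 1 ->
  (1 - tau) * (planted_prob R k (fun G : {set {set 'I_n}} => prepares_target A tau G k)
    - planted_prob R k (fun G : {set {set 'I_n}} => [exists T, obstructed k G T]))
  <= planted_expect k (fun G : {set {set 'I_n}} => find_prob (extended_alg A) G k).
Proof.
move=> k3 kn tau1; rewrite -planted_expectB; apply: planted_expect_le => G gG clG.
have find0 := find_prob_ge0 (extended_alg A) G k.
have [bad|nbad] := boolP [exists T, obstructed k G T].
  apply: le_trans find0; apply: mulr_ge0_le0; first by rewrite subr_ge0 ltW.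
  by rewrite subr_le0 ler_nat leq_b1.
case: (boolP (prepares_target A tau G k)) => [prep|_]; rewrite subr0 ?mulr0 // mulr1.
by apply: prepares_find_prob => //; rewrite negb_exists in nbad.
Qed.

End PlantedExpectation.

(** * Estimates for large n *)

Section Asymptotics.
Variable R : realType.

Lemma powR_expR n (x : R) : (0 < n)%N -> n%:R `^ x = expR (x * ln n%:R).
Proof. by move=> n0; rewrite /powR gt_eqF ?ltr0n. Qed.

(** With $y = ax/4 \le e^y$, the threshold $16/a^2$ gives $x \le y^2 \le e^{ax/2}$, and the other
    threshold gives $b \le ax/2$. *)
Lemma le_expR_affine (a b : R) : 0 < a ->
  exists K : R, forall x, K <= x -> x <= expR (a * x - b).
Proof.
move=> a0; exists (Num.max (2 * `|b| / a) (16 / a ^+ 2)) => x.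
rewrite ge_max => /andP[]; rewrite ler_pdivrMr // ler_pdivrMr ?exprn_gt0 // => h1 h2.
have xge0 : 0 <= x by nra.
apply: (@le_trans _ _ (expR (a * x / 2))); last first.
  by rewrite ler_expR; have := ler_norm b; lra.
have -> : a * x / 2 = a * x / 4 + a * x / 4 by field.
rewrite expRD; have := expR_ge1Dx (a * x / 4).
have y0 : 0 <= a * x / 4 by rewrite divr_ge0 // mulr_ge0 // ltW.
have xy : x <= (a * x / 4) * (a * x / 4) by nra.
move: (expR _) => e he; apply: le_trans xy _.
by apply: ler_pM => //; lra.
Qed.

Lemma planted_range_small (eps alpha : R) : 0 < eps ->
  exists K : R, forall n k : nat, (0 < n)%N -> planted_range eps alpha n k ->
    K <= k%:R -> n%:R * k%:R / 2 ^+ (k - 2)./2 <= n%:R `^ (- (eps / 4)).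
Proof.
move=> eps0.
have ln2 : 0 < ln 2 :> R by rewrite ln_gt0 // ltr1n.
(* This is the slack in $\frac12 = \frac{1+\varepsilon/4}{2+\varepsilon} +
   \frac{\varepsilon}{4(2+\varepsilon)}$: the first part of $k \ln 2 / 2$ pays for
   $n^{1+\varepsilon/4}$, the second for the factor [k]. The offset [3 / 2 * ln 2] below covers the
   rounding in [(k - 2)./2]. *)
pose a : R := eps / (4 * (2 + eps)) * ln 2.
have a0 : 0 < a by rewrite mulr_gt0 // divr_gt0 //; lra.
have [K hK] := le_expR_affine (3 / 2 * ln 2) a0.
exists K => n k n0 /andP[+ _] /hK hk; rewrite /log2 => hrange.
have n0' : 0 < n%:R :> R by rewrite ltr0n.
have hh : (k%:R - 3) / 2 <= ((k - 2)./2)%:R :> R.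
  have : (k <= (k - 2)./2 * 2 + 3)%N by lia.
  by rewrite -(ler_nat R) natrD natrM; lra.
have -> : 2 ^+ (k - 2)./2 = expR (((k - 2)./2)%:R * ln 2) :> R.
  by rewrite mulrC expRM_natr lnK // posrE.
rewrite powR_expR // ler_pdivrMr ?expR_gt0 // -expRD.
rewrite -{1}[n%:R]lnK ?posrE //.
apply: le_trans (ler_wpM2l (ltW (expR_gt0 _)) hk) _.
rewrite -expRD ler_expR.
have hln : ln n%:R * (2 + eps) <= k%:R * ln 2.
  by move: hrange; rewrite mulrA ler_pdivrMr // mulrC.
have e1 : a * k%:R = eps / (4 * (2 + eps)) * (k%:R * ln 2) by rewrite /a; ring.
have h2 : (k%:R - 3) / 2 * ln 2 <= ((k - 2)./2)%:R * ln 2 :> R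
  by apply: ler_wpM2r => //; apply: ltW.
suff : (1 + eps / 4) * ln n%:R + a * k%:R <= k%:R * ln 2 / 2 by lra.
have p2 : 0 < 2 + eps by lra.
have -> : k%:R * ln 2 / 2 = (1 + eps / 4) / (2 + eps) * (k%:R * ln 2) + a * k%:R.
  by rewrite e1; field; rewrite gt_eqF.
rewrite lerD2r -[leRHS]mulrA; apply: ler_wpM2l; first lra.
by rewrite mulrC ler_pdivlMr.
Qed.

Lemma planted_range_large (eps alpha K : R) : 0 < eps ->
  exists N : nat, forall n k : nat, (N <= n)%N -> planted_range eps alpha n k ->
    K <= k%:R.
Proof.
move=> eps0; have ln2 : 0 < ln 2 :> R by rewrite ln_gt0 // ltr1n.
exists (Num.bound (expR (`|K| * ln 2))) => n k Nn /andP[+ _].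
have le_n : expR (`|K| * ln 2) <= n%:R.
  apply: (@le_trans _ _ (Num.bound (expR (`|K| * ln 2)))%:R); last by rewrite ler_nat.
  by apply/ltW/archi_boundP/ltW/expR_gt0.
have n0 : 0 < n%:R :> R by apply: lt_le_trans le_n; apply: expR_gt0.
have : `|K| * ln 2 <= ln n%:R by rewrite -ler_expR lnK ?posrE.
rewrite -ler_pdivlMr // -/(log2 R n); have := ler_norm K; have := normr_ge0 K.
by move=> h1 h2 h3 h4; nra.
Qed.

Lemma planted_range_le (eps alpha : R) n k : 0 < alpha -> (0 < n)%N ->
  planted_range eps alpha n k -> (k <= n)%N.
Proof.
move=> al0 n0 /andP[_ h]; rewrite -(ler_nat R); apply: le_trans h _.
rewrite -[leRHS]powRr1 ?ler0n //; apply: ler_powR; first by rewrite ler1n.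
lra.
Qed.

Lemma obstructed_prob_small (eps alpha c : R) : 0 < eps -> 0 < alpha -> 0 < c ->
  exists N : nat, forall n k : nat, (N <= n)%N -> planted_range eps alpha n k ->
    [/\ (0 < n)%N, (2 < k)%N, (k <= n)%N &
    planted_prob R k (fun G : {set {set 'I_n}} => [exists T, obstructed k G T])
    <= n%:R `^ (- c) / 2].
Proof.
move=> eps0 al0 c0.
(* Then $q^m \le n^{-c-4}$; the surplus $n^{-4}$ absorbs the coefficient $k^2 + 4^{m^2} \le
   n^4/2$. *)
pose m := Num.bound ((c + 4) / (eps / 4)).
have hm : c + 4 <= eps / 4 * m%:R.
  rewrite mulrC -ler_pdivrMr; last lra.
  by apply/ltW/archi_boundP; rewrite divr_ge0 //; lra.
have [K hK] := planted_range_small alpha eps0.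
have [N hN] := planted_range_large alpha (Num.max K (2 * m + 3)%:R) eps0.
exists (maxn N (4 ^ (m * m) + 2)) => n k; rewrite geq_max => /andP[/hN h le_n] range.
have := h k range; rewrite ge_max ler_nat => /andP[/hK q_small mk].
have n0 : (0 < n)%N by lia.
have kn := planted_range_le al0 n0 range.
have {}q_small := q_small n n0 range.
split=> //; first by lia.
set q := _ / _ in q_small.
have q0 : 0 <= q by rewrite divr_ge0 ?mulr_ge0 ?exprn_ge0.
have n1 : 1 <= n%:R :> R by rewrite ler1n.
have q1 : q <= 1.
  apply: le_trans q_small _; rewrite -[leRHS](powRr0 n%:R); apply: ler_powR => //; lra.
apply: le_trans (planted_prob_obstructed (m := m) _ _ q1) _; [lia|lia|].
rewrite -/q.
have qm : q ^+ m <= n%:R `^ (- c) * n%:R `^ (- 4).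
  apply: (@le_trans _ _ ((n%:R `^ (- (eps / 4))) ^+ m)).
    by rewrite lerXn2r ?nnegrE ?powR_ge0.
  rewrite -powR_mulrn ?powR_ge0 // -powRrM.
  rewrite -powRD ?(gt_eqF (lt_le_trans ltr01 n1)) ?implybT //.
  by apply: ler_powR => //; lra.
have coef : k%:R ^+ 2 + 4 ^+ (m * m) <= n%:R ^+ 4 / 2 :> R.
  have : (2 * (k ^ 2 + 4 ^ (m * m)) <= n ^ 4)%N.
    have kn2 : (k ^ 2 <= n ^ 2)%N by rewrite leq_exp2r.
    rewrite (_ : n ^ 4 = n ^ 2 * n ^ 2)%N; last by rewrite -expnD.
    have n2 : (n * n = n ^ 2)%N by rewrite mulnn.
    have z4 : (4 <= n ^ 2)%N by nia.
    have xz : (4 ^ (m * m) <= n ^ 2)%N by nia.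
    by move: (n ^ 2)%N (k ^ 2)%N (4 ^ _)%N kn2 z4 xz => x y z; nia.
  rewrite -(ler_nat R) natrM natrD !natrX; lra.
have p4 : n%:R `^ (- 4) = (n%:R ^+ 4)^-1 :> R.
  by rewrite powRN -powR_mulrn ?ler0n.
apply: le_trans (ler_pM _ _ coef qm) _; rewrite ?addr_ge0 ?exprn_ge0 //.
rewrite p4 le_eqVlt; apply/orP; left; apply/eqP; field.
by rewrite pnatr_eq0 -lt0n.
Qed.

End Asymptotics.

Theorem corollary7 (R : realType) (eps : R) (k : nat -> nat)
  (heps : 0 < eps < 2^-1)
  (hk : exists N : nat, forall n : nat, (N <= n)%N ->
     planted_range eps eps n (k n))
  (hconj : strong_search_planted_clique_conjecture R) :
  forall c tau : R, 0 < c -> 0 < tau < 1 ->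
  ~ exists A : poly_quantum_alg R,
      exists N : nat, forall n : nat, (N <= n)%N ->
        n%:R `^ (- c) <=
          planted_prob R (k n)
            (fun G : {set {set 'I_n}} => prepares_target A tau G (k n)).
Proof.
move=> c tau c0 /andP[_ tau1] [A [N1 hA]]; have /andP[eps0 _] := heps.
have [N2 hk2] := hk; have [N3 bad] := obstructed_prob_small eps0 eps0 c0.
(* The exponent [c + 1] gains a factor [n], which exceeds the constant [2 / (1 - tau)] once [n] is
   at least [N5]. *)
have [|N4 conj] := hconj eps eps (c + 1) eps0 heps _ (extended_alg A); first lra.
pose N5 := Num.bound (2 / (1 - tau)).
pose n := (N1 + N2 + N3 + N4 + N5)%N.
have range : planted_range eps eps n (k n) by apply: hk2; rewrite /n; lia.
have [le1 le3 le4 le5] : [/\ (N1 <= n)%N, (N3 <= n)%N, (N4 <= n)%N & (N5 <= n)%N].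
  by rewrite /n; split; lia.
have [n0 k3 kn bad_n] := bad n (k n) le3 range.
have {}hA := hA n le1; have conj_n := conj n (k n) le4 range.
have := le_trans (extended_expectation A k3 kn tau1) conj_n.
have n0' : 0 < n%:R :> R by rewrite ltr0n.
have npos : 0 < n%:R `^ (- c) :> R by rewrite powR_gt0.
have -> : n%:R `^ (- (c + 1)) = n%:R `^ (- c) / n%:R :> R.
  by rewrite opprD powRD ?(gt_eqF n0') ?implybT // powR_inv1 // ltW.
apply/negP; rewrite -ltNge ltr_pdivrMr //.
have tau0 : 0 < 1 - tau by rewrite subr_gt0.
have N5n : 2 / (1 - tau) < n%:R.
  apply: (@lt_le_trans _ _ N5%:R); last by rewrite ler_nat.
  by apply: archi_boundP; rewrite divr_ge0 // ltW.
rewrite ltr_pdivrMr // in N5n.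
move: (planted_prob _ _ _) (planted_prob _ _ _) hA bad_n => y x hx hy.
(* Discarding the obstructed graphs costs at most half of the assumed probability. *)
have hxy : n%:R `^ (- c) / 2 <= x - y by lra.
have key p r t d : 0 < p -> 0 < r * t -> 2 < r * t -> p / 2 <= d -> p < t * d * r :> R.
  move=> p0 rt0 rt2 /(ler_wpM2l (ltW rt0)) pd.
  have : p * 2 < p * (r * t) by rewrite ltr_pM2l.
  lra.
by apply: key => //; apply: mulr_gt0.
Qed.
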